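(* Let $n\geq 2$ be an integer. The holomorphic closed 1-form $$\omega_n=(-1)^n\frac{n-1}{n!}u^{n-2}(u\,dv-v\,du)$$ on $\widehat{\mathbb C}_{\pm}$ has periods in $\frac{(2\pi i)^n}{(n-1)!}\mathbb Z$ on $\widehat{\mathbb C}_{++}$ and $\widehat{\mathbb C}_{+-}$, and periods in $\kappa_n\frac{(2\pi i)^n}{(n-1)!}\mathbb Z$ on $\widehat{\mathbb C}_{-+}$ and $\widehat{\mathbb C}_{--}$.
   Context: For signs $\epsilon_1,\epsilon_2\in\{1,-1\}$ let $\widehat{\mathbb C}_{\epsilon_1\epsilon_2}=\{(u,v)\in\mathbb C^2 : \epsilon_1e^u+\epsilon_2e^v=1\}$ (subscripts are written as $+,-$), and let $\widehat{\mathbb C}_{\pm}$ be the disjoint union of the four Riemann surfaces $\widehat{\mathbb C}_{++},\widehat{\mathbb C}_{-+},\widehat{\mathbb C}_{+-},\widehat{\mathbb C}_{--}$. The periods of a closed form on a component are its integrals over closed loops in that component. With $\nu_2$ the 2-adic valuation, $\kappa_n=2^{2-n}$ if $n$ is even and $\kappa_n=2^{3+\nu_2(n-1)-n}$ if $n$ is odd. *)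

(* Defs.v *)
From Stdlib Require Import Reals Factorial.
From Coquelicot Require Import Coquelicot.
From mathcomp Require prime.

Open Scope C_scope.

Inductive Sign : Set := Plus | Minus.

Definition sgn (e : Sign) : C :=
  match e with Plus => RtoC 1 | Minus => RtoC (-1) end.

Definition Cexp (z : C) : C :=
  ((exp (Re z) * cos (Im z))%R, (exp (Re z) * sin (Im z))%R).

(* Points of [C * C] are pairs (u, v). *)
Definition Chat (e1 e2 : Sign) (p : C * C) : Prop :=
  sgn e1 * Cexp (fst p) + sgn e2 * Cexp (snd p) = RtoC 1.

(* The kernel of the differential of sgn e1 * e^u + sgn e2 * e^v, which never
   vanishes, so that this is a complex line. *)
Definition tangent_Chat (e1 e2 : Sign) (p X : C * C) : Prop :=
  sgn e1 * Cexp (fst p) * fst X + sgn e2 * Cexp (snd p) * snd X = RtoC 0.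

(* The 1-form P du + Q dv on C^2 with P = [du_coef] and Q = [dv_coef]; a form
   on [Chat e1 e2] is given as the restriction of such a form. *)
Record one_form := OneForm {
  du_coef : C * C -> C;
  dv_coef : C * C -> C
}.

(* Complex Frechet differentiability of a function of two complex variables. *)
Definition C2_differentiable (f : C * C -> C) (p : C * C) : Prop :=
  ex_filterdiff (K := C_AbsRing)
    (U := prod_NormedModule C_AbsRing C_NormedModule C_NormedModule)
    (V := C_NormedModule) f (locally p).

Definition holomorphic_form (w : one_form) : Prop :=
  forall p, C2_differentiable (du_coef w) p /\ C2_differentiable (dv_coef w) p.

(* d(P du + Q dv) = (dQ/du - dP/dv) du /\ dv, evaluated on the vectors X, Y. *)
Definition ext_deriv (w : one_form) (p X Y : C * C) : C :=
  (C_derive (fun u => dv_coef w (u, snd p)) (fst p)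
   - C_derive (fun v => du_coef w (fst p, v)) (snd p))
  * (fst X * snd Y - snd X * fst Y).

Definition closed_form_on_Chat (e1 e2 : Sign) (w : one_form) : Prop :=
  forall p X Y, Chat e1 e2 p ->
    tangent_Chat e1 e2 p X -> tangent_Chat e1 e2 p Y ->
    ext_deriv w p X Y = RtoC 0.

Definition C1_on (g : R -> C * C) (a b : R) : Prop :=
  exists h dh : R -> prod_NormedModule R_AbsRing C_R_NormedModule C_R_NormedModule,
    (forall t : R, is_derive (K := R_AbsRing) h t (dh t)) /\
    (forall t : R, continuous dh t) /\
    (forall t : R, (a <= t <= b)%R -> g t = h t).

Inductive piecewise_C1 (g : R -> C * C) : R -> R -> Prop :=
| piecewise_C1_one a b : (a < b)%R -> C1_on g a b -> piecewise_C1 g a b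
| piecewise_C1_cat a b c :
    piecewise_C1 g a b -> piecewise_C1 g b c -> piecewise_C1 g a c.

Record closed_loop_in (S : C * C -> Prop) (g : R -> C * C) : Prop := {
  loop_piecewise_C1 : piecewise_C1 g 0 1;
  loop_closed : g 0%R = g 1%R;
  loop_in : forall t, (0 <= t <= 1)%R -> S (g t)
}.

(* At the finitely many break points of a piecewise C^1 path the value is
   arbitrary, which does not affect integrals. *)
Definition velocity (f : R -> C) (t : R) : C :=
  (Derive (fun s => Re (f s)) t, Derive (fun s => Im (f s)) t).

Definition line_integral (w : one_form) (g : R -> C * C) : C :=
  RInt (V := C_R_CompleteNormedModule)
    (fun t => du_coef w (g t) * velocity (fun s => fst (g s)) t
              + dv_coef w (g t) * velocity (fun s => snd (g s)) t) 0 1.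

Definition is_period (S : C * C -> Prop) (w : one_form) (z : C) : Prop :=
  exists g, closed_loop_in S g /\ z = line_integral w g.

Definition integer_multiple (c z : C) : Prop :=
  exists k : Z, z = c * RtoC (IZR k).

Definition has_periods_in (S : C * C -> Prop) (w : one_form) (A : C -> Prop) : Prop :=
  forall z, is_period S w z -> A z.

(* (-1)^n (n-1)/n! u^(n-2) (u dv - v du) *)
Definition omega (n : nat) : one_form :=
  let c := RtoC ((-1) ^ n * (INR n - 1) / INR (fact n)) in
  {| du_coef := fun p => c * fst p ^ (n - 2) * - snd p;
     dv_coef := fun p => c * fst p ^ (n - 2) * fst p |}.

Definition kappa (n : nat) : R :=
  if Nat.even n then powerRZ 2 (2 - Z.of_nat n)
  else powerRZ 2 (3 + Z.of_nat (prime.logn 2 (n - 1)) - Z.of_nat n).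

(* (2 pi i)^n / (n-1)! *)
Definition period_unit (n : nat) : C :=
  (RtoC 2 * RtoC PI * Ci) ^ n / RtoC (INR (fact (n - 1))).

(* Main.v *)
Require Import Defs.
From Stdlib Require Import Reals Lra Lia ZArith.
From Coquelicot Require Import Coquelicot.
From Corelib Require ssrbool.
From mathcomp Require ssrnat div prime.

(** Write [m = n - 1] and [c = 0] or [1] according as [e1] is [Plus] or [Minus],
    so that [sgn e1 = exp (- i pi c)].

    Integration by parts: [omega n] equals [(-1)^n / m! (u^m - A) dv] plus the
    differential of a polynomial in [u, v], for every constant [A]; the choice
    [A = (i pi c)^m] is made.  Along [Chat e1 e2] the defining equation gives
    [dv = q (u - i pi c) du] with [q z = e^z / (e^z - 1)], a function whose poles
    [2 pi i k] are simple with residue 1.  A period of [omega n] is therefore the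
    integral of [(-1)^n / m! (u^m - A) q (u - i pi c) du] over a closed curve in
    the [u]-plane that avoids the points [i pi b], [b] congruent to [c] modulo 2,
    and by residues it is an integral combination of the numbers
    [(-1)^n / m! 2 pi i ((i pi b)^m - (i pi c)^m)], that is of
    [(2 pi i)^n / m! (b^m - c^m) / 2^m] ([periods_omega], [period_multiple]).
    When [c = 0], [b] is even and [2^m] divides [b^m].  When [c = 1], [b] is odd;
    [b^m - 1] is even, and divisible by [2^(v + 2)], [v] the 2-adic valuation of
    [m], when [m] is even ([odd_pow_sub_1_divide]); this is what [kappa n] records.

    The residue theorem is obtained by elementary means, in two steps.

    One pole ([residue_single_pole]).  If [k] is holomorphic on a punctured disc
    centred at [al], then the integral of [k u du] over a closed curve does not
    change when the curve is contracted towards [al] by a dilation, since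
    differentiating [s k (al + s (u - al))] in [s] exhibits a primitive of the
    difference ([dilation_potential]).  In the limit only the residue remains, times
    the integral of [du / (u - al)], which is in [2 pi i Z] because its exponential
    is 1 ([winding_number]).

    Several poles ([dlog_dilated_residues]).  The duplication formula
    [q z = (q (z/2) + q (z/2 + i pi)) / 2] splits the poles of [q] into those at
    even and those at odd places.  Iterating it writes [q] as a sum of functions
    [q ((u - al) / M) / M] with [al] at distance at most [pi M] from 0 and poles
    [2 pi M] apart.  For large [M] a given bounded curve lies in the punctured disc of
    radius [2 pi M] about [al], which contains no other pole, so that the first
    step applies to each summand. *)

Local Open Scope C_scope.

(** * Calculus of complex-valued functions of a real variable *)

Notation is_derive_C w t d :=
  (is_derive (K := R_AbsRing) (V := C_R_NormedModule) w t (d : C)).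

Lemma continuous_Re {U : UniformSpace} (f : U -> C) (x : U) :
  continuous f x -> continuous (fun y => Re (f y)) x.
Proof.
  intros Hf.
  apply (continuous_comp f (fun z : C => fst z)); [exact Hf | apply continuous_fst].
Qed.

Lemma continuous_Im {U : UniformSpace} (f : U -> C) (x : U) :
  continuous f x -> continuous (fun y => Im (f y)) x.
Proof.
  intros Hf.
  apply (continuous_comp f (fun z : C => snd z)); [exact Hf | apply continuous_snd].
Qed.

Lemma continuous_C_parts {U : UniformSpace} (f : U -> C) (x : U) :
  continuous (fun y => Re (f y)) x -> continuous (fun y => Im (f y)) x ->
  continuous f x.
Proof.
  intros Hr Hi.
  apply (continuous_ext (fun y => (Re (f y), Im (f y)) : C)).
  { intros y; unfold Re, Im; destruct (f y); reflexivity. }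
  apply (continuous_comp_2 (fun y => Re (f y)) (fun y => Im (f y)) (fun a b => (a, b) : C));
    trivial.
  apply (continuous_ext (fun p : R * R => p)); [now intros [a b] | apply continuous_id].
Qed.

Lemma continuous_Cplus {U : UniformSpace} (f g : U -> C) (x : U) :
  continuous f x -> continuous g x -> continuous (fun y => f y + g y) x.
Proof.
  intros Hf Hg. apply continuous_C_parts; simpl.
  - apply (continuous_plus (V := R_NormedModule) (fun y => Re (f y)) (fun y => Re (g y)));
      now apply continuous_Re.
  - apply (continuous_plus (V := R_NormedModule) (fun y => Im (f y)) (fun y => Im (g y)));
      now apply continuous_Im.
Qed.

Lemma continuous_Copp {U : UniformSpace} (f : U -> C) (x : U) :
  continuous f x -> continuous (fun y => - f y) x.
Proof.
  intros Hf. apply continuous_C_parts; simpl.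
  - apply (continuous_opp (V := R_NormedModule) (fun y => Re (f y))); now apply continuous_Re.
  - apply (continuous_opp (V := R_NormedModule) (fun y => Im (f y))); now apply continuous_Im.
Qed.

Lemma continuous_Cminus {U : UniformSpace} (f g : U -> C) (x : U) :
  continuous f x -> continuous g x -> continuous (fun y => f y - g y) x.
Proof. intros Hf Hg. apply continuous_Cplus; [|apply continuous_Copp]; trivial. Qed.

Lemma continuous_Cmult {U : UniformSpace} (f g : U -> C) (x : U) :
  continuous f x -> continuous g x -> continuous (fun y => f y * g y) x.
Proof.
  intros Hf Hg.
  pose proof (continuous_Re f x Hf) as F1. pose proof (continuous_Im f x Hf) as F2.
  pose proof (continuous_Re g x Hg) as G1. pose proof (continuous_Im g x Hg) as G2.
  apply continuous_C_parts; simpl.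
  - apply (continuous_minus (V := R_NormedModule) (fun y => Re (f y) * Re (g y))%R
             (fun y => Im (f y) * Im (g y))%R);
      apply (continuous_mult (K := R_AbsRing)); trivial.
  - apply (continuous_plus (V := R_NormedModule) (fun y => Re (f y) * Im (g y))%R
             (fun y => Im (f y) * Re (g y))%R);
      apply (continuous_mult (K := R_AbsRing)); trivial.
Qed.

Lemma Cmod2_neq_0 (z : C) : z <> 0 -> (fst z ^ 2 + snd z ^ 2)%R <> 0%R.
Proof.
  intros Hz H. apply Hz. destruct z as [a b]; simpl in H.
  assert (a = 0%R) by nra. assert (b = 0%R) by nra. subst. reflexivity.
Qed.

Lemma continuous_Cinv {U : UniformSpace} (f : U -> C) (x : U) :
  continuous f x -> f x <> 0 -> continuous (fun y => / f y) x.
Proof.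
  intros Hf H0. pose proof (Cmod2_neq_0 _ H0) as H2.
  pose proof (continuous_Re f x Hf) as F1. pose proof (continuous_Im f x Hf) as F2.
  assert (D : continuous (fun y => / (fst (f y) ^ 2 + snd (f y) ^ 2))%R x).
  { apply (continuous_comp (fun y => (fst (f y) ^ 2 + snd (f y) ^ 2)%R) Rinv).
    - apply (continuous_ext (fun y => Re (f y) * Re (f y) + Im (f y) * Im (f y))%R).
      { intros y.
        change (fst (f y) * fst (f y) + snd (f y) * snd (f y) = fst (f y) ^ 2 + snd (f y) ^ 2)%R.
        ring. }
      apply (continuous_plus (V := R_NormedModule) (fun y => Re (f y) * Re (f y))%R
               (fun y => Im (f y) * Im (f y))%R);
        apply (continuous_mult (K := R_AbsRing)); assumption.
    - now apply continuous_Rinv. }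
  apply continuous_C_parts.
  - exact (continuous_mult (K := R_AbsRing) (fun y => Re (f y)) _ x F1 D).
  - exact (continuous_mult (K := R_AbsRing) (fun y => - Im (f y))%R _ x
             (continuous_opp (V := R_NormedModule) (fun y => Im (f y)) x F2) D).
Qed.

Lemma continuous_Cexp {U : UniformSpace} (f : U -> C) (x : U) :
  continuous f x -> continuous (fun y => Cexp (f y)) x.
Proof.
  intros Hf.
  pose proof (continuous_Re f x Hf) as F1. pose proof (continuous_Im f x Hf) as F2.
  pose proof (continuous_comp (fun y => Re (f y)) exp x F1 (continuous_exp _)) as E.
  apply continuous_C_parts.
  - exact (continuous_mult (K := R_AbsRing) (fun y => exp (Re (f y))) (fun y => cos (Im (f y))) x E
      (continuous_comp (fun y => Im (f y)) cos x F2 (continuous_cos _))).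
  - exact (continuous_mult (K := R_AbsRing) (fun y => exp (Re (f y))) (fun y => sin (Im (f y))) x E
      (continuous_comp (fun y => Im (f y)) sin x F2 (continuous_sin _))).
Qed.

Lemma continuous_RtoC {U : UniformSpace} (f : U -> R) (x : U) :
  continuous f x -> continuous (fun y => RtoC (f y)) x.
Proof. intros Hf. apply continuous_C_parts; simpl; trivial. apply continuous_const. Qed.

Lemma continuous_Cpow {U : UniformSpace} (f : U -> C) (x : U) (n : nat) :
  continuous f x -> continuous (fun y => f y ^ n) x.
Proof.
  intros Hf. induction n as [|n IH]; simpl.
  - apply continuous_const.
  - apply continuous_Cmult; trivial.
Qed.

Lemma continuous_Cmod {U : UniformSpace} (f : U -> C) (x : U) :
  continuous f x -> continuous (fun y => Cmod (f y)) x.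
Proof.
  intros Hf.
  apply (continuous_comp f Cmod); trivial.
  exact (filterlim_norm (V := C_NormedModule) (f x)).
Qed.

Lemma is_derive_C_Re (w : R -> C) (t : R) (d : C) :
  is_derive_C w t d -> is_derive (fun s => Re (w s)) t (Re d).
Proof.
  intros H.
  apply (filterdiff_ext_lin _ (fun y : R => Re (scal (V := C_R_NormedModule) y d)));
    [|now intros y].
  apply (filterdiff_comp' (V := C_R_NormedModule) w (fun z : C => Re z) t _ (fun z => Re z) H).
  apply filterdiff_linear, (is_linear_fst (U := R_NormedModule) (V := R_NormedModule)).
Qed.

Lemma is_derive_C_Im (w : R -> C) (t : R) (d : C) :
  is_derive_C w t d -> is_derive (fun s => Im (w s)) t (Im d).
Proof.
  intros H.
  apply (filterdiff_ext_lin _ (fun y : R => Im (scal (V := C_R_NormedModule) y d)));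
    [|now intros y].
  apply (filterdiff_comp' (V := C_R_NormedModule) w (fun z : C => Im z) t _ (fun z => Im z) H).
  apply filterdiff_linear, (is_linear_snd (U := R_NormedModule) (V := R_NormedModule)).
Qed.

Lemma is_derive_C_parts (w : R -> C) (t : R) (d : C) :
  is_derive (fun s => Re (w s)) t (Re d) -> is_derive (fun s => Im (w s)) t (Im d) ->
  is_derive_C w t d.
Proof.
  intros Hr Hi.
  apply (is_derive_ext (K := R_AbsRing) (V := C_R_NormedModule)
           (fun s => (Re (w s), Im (w s)) : C)).
  { intros s; unfold Re, Im; destruct (w s); reflexivity. }
  assert (P : forall t', filterdiff (K := R_AbsRing)
     (U := prod_NormedModule R_AbsRing R_NormedModule R_NormedModule)
     (V := C_R_NormedModule) (fun u => (fst u, snd u)) (locally t') (fun u => (fst u, snd u))).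
  { intros t'. apply (filterdiff_ext (fun u => u)); [now intros []|].
    apply (filterdiff_ext_lin _ (fun u => u)); [apply filterdiff_id | now intros []]. }
  pose proof (filterdiff_comp'_2 (K := R_AbsRing) (U := R_NormedModule)
    (V := R_NormedModule) (W := C_R_NormedModule) (fun s => Re (w s)) (fun s => Im (w s))
    (fun a b => (a, b)) t _ _ (fun a b => (a, b)) Hr Hi (P _)) as H.
  apply (filterdiff_ext_lin _ _ _ H).
  intros y. reflexivity.
Qed.

Lemma norm_C_R (z : C) : norm (V := C_R_NormedModule) z = Cmod z.
Proof.
  destruct z as [a b]. unfold Cmod.
  change (sqrt (Rabs a ^ 2 + Rabs b ^ 2) = sqrt (a ^ 2 + b ^ 2))%R.
  now rewrite !pow2_abs.
Qed.

Lemma is_derive_C_const (c : C) (t : R) : is_derive_C (fun _ => c) t 0.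
Proof. apply (is_derive_const (K := R_AbsRing) (V := C_R_NormedModule)). Qed.

Lemma is_derive_C_RtoC (f : R -> R) (t d : R) :
  is_derive f t d -> is_derive_C (fun s => RtoC (f s)) t d.
Proof.
  intros H. apply is_derive_C_parts; simpl; trivial.
  exact (is_derive_const (K := R_AbsRing) (V := R_NormedModule) 0%R t).
Qed.

Lemma is_derive_C_plus (x y : R -> C) (t : R) (dx dy : C) :
  is_derive_C x t dx -> is_derive_C y t dy -> is_derive_C (fun s => x s + y s) t (dx + dy).
Proof. apply (is_derive_plus (K := R_AbsRing) (V := C_R_NormedModule)). Qed.

Lemma is_derive_C_minus (x y : R -> C) (t : R) (dx dy : C) :
  is_derive_C x t dx -> is_derive_C y t dy -> is_derive_C (fun s => x s - y s) t (dx - dy).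
Proof. apply (is_derive_minus (K := R_AbsRing) (V := C_R_NormedModule)). Qed.

Lemma is_derive_C_mult (x y : R -> C) (t : R) (dx dy : C) :
  is_derive_C x t dx -> is_derive_C y t dy ->
  is_derive_C (fun s => x s * y s) t (dx * y t + x t * dy).
Proof.
  intros Hx Hy.
  pose proof (is_derive_C_Re _ _ _ Hx) as X1. pose proof (is_derive_C_Im _ _ _ Hx) as X2.
  pose proof (is_derive_C_Re _ _ _ Hy) as Y1. pose proof (is_derive_C_Im _ _ _ Hy) as Y2.
  apply is_derive_C_parts; simpl; unfold Re, Im in *.
  - evar_last.
    { apply (is_derive_minus (K := R_AbsRing) (V := R_NormedModule)
               (fun s => fst (x s) * fst (y s))%R (fun s => snd (x s) * snd (y s))%R);
        apply (is_derive_mult (K := R_AbsRing)); eauto; intros; apply Rmult_comm. }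
    unfold minus, plus, opp, mult; simpl. unfold plus, mult, opp; simpl. ring.
  - evar_last.
    { apply (is_derive_plus (K := R_AbsRing) (V := R_NormedModule)
               (fun s => fst (x s) * snd (y s))%R (fun s => snd (x s) * fst (y s))%R);
        apply (is_derive_mult (K := R_AbsRing)); eauto; intros; apply Rmult_comm. }
    unfold minus, plus, opp, mult; simpl. unfold plus, mult, opp; simpl. ring.
Qed.

Lemma is_derive_C_inv (x : R -> C) (t : R) (dx : C) :
  is_derive_C x t dx -> x t <> 0 -> is_derive_C (fun s => / x s) t (- dx / (x t * x t)).
Proof.
  intros Hx H0. pose proof (Cmod2_neq_0 _ H0) as H2.
  pose proof (is_derive_C_Re _ _ _ Hx) as X1. pose proof (is_derive_C_Im _ _ _ Hx) as X2.
  replace (- dx / (x t * x t)) with (- dx * (/ x t * / x t)) by (field; trivial).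
  assert (Q : forall a b : R -> R, forall da db : R, is_derive a t da -> is_derive b t db ->
    (a t ^ 2 + b t ^ 2 <> 0)%R ->
    is_derive (fun s => a s / (a s ^ 2 + b s ^ 2))%R t
      ((da * (a t ^ 2 + b t ^ 2) - a t * (2 * a t * da + 2 * b t * db))
        / (a t ^ 2 + b t ^ 2) ^ 2)%R).
  { intros a b da db Ha Hb H. auto_derive.
    - repeat split; try (now exists da); [now exists db | exact H].
    - assert (Ea : Derive (fun s : R => a s) t = da) by exact (is_derive_unique _ _ _ Ha).
      assert (Eb : Derive (fun s : R => b s) t = db) by exact (is_derive_unique _ _ _ Hb).
      rewrite Ea, Eb. field. intros E; apply H; simpl in *; lra. }
  apply is_derive_C_parts.
  - evar_last; [exact (Q _ _ _ _ X1 X2 H2) |].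
    simpl. unfold Re, Im. field. simpl in H2. intros E; apply H2; lra.
  - evar_last.
    + apply (is_derive_ext (fun s => - (snd (x s) / (snd (x s) ^ 2 + fst (x s) ^ 2)))%R).
      { intros s. simpl. rewrite (Rplus_comm (snd (x s) * _)%R). unfold Rdiv. ring. }
      apply (is_derive_opp (V := R_NormedModule)). apply (Q _ _ _ _ X2 X1).
      now rewrite Rplus_comm.
    + unfold opp; simpl. unfold Re, Im. field. simpl in H2. intros E; apply H2; lra.
Qed.

Lemma is_derive_C_exp (x : R -> C) (t : R) (dx : C) :
  is_derive_C x t dx -> is_derive_C (fun s => Cexp (x s)) t (Cexp (x t) * dx).
Proof.
  intros Hx.
  pose proof (is_derive_C_Re _ _ _ Hx) as X1. pose proof (is_derive_C_Im _ _ _ Hx) as X2.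
  assert (Q : forall (trig dtrig : R -> R) (a b : R -> R) (da db : R),
    is_derive trig (b t) (dtrig (b t)) -> is_derive a t da -> is_derive b t db ->
    is_derive (fun s => exp (a s) * trig (b s))%R t
      (exp (a t) * (da * trig (b t) + db * dtrig (b t)))%R).
  { intros trig dtrig a b da db Ht Ha Hb. auto_derive.
    - repeat split; [now exists da | now exists (dtrig (b t)) | now exists db].
    - assert (Ea : Derive (fun s : R => a s) t = da) by exact (is_derive_unique _ _ _ Ha).
      assert (Eb : Derive (fun s : R => b s) t = db) by exact (is_derive_unique _ _ _ Hb).
      assert (Et : Derive (fun s : R => trig s) (b t) = dtrig (b t))
        by exact (is_derive_unique _ _ _ Ht).
      rewrite Ea, Eb, Et. ring. }
  apply is_derive_C_parts.
  - evar_last; [apply (Q cos (fun s => - sin s)%R); [apply is_derive_cos | exact X1 | exact X2] |].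
    simpl. unfold Re, Im. ring.
  - evar_last; [apply (Q sin cos); [apply is_derive_sin | exact X1 | exact X2] |].
    simpl. unfold Re, Im. ring.
Qed.

(** * Complex-valued integrals and holomorphic functions *)

Notation is_RInt_C f a b I := (is_RInt (V := C_R_NormedModule) f a b (I : C)).
Notation RInt_C f a b := (RInt (V := C_R_CompleteNormedModule) f a b : C).

Lemma is_RInt_C_parts (f : R -> C) (a b : R) (I : C) :
  is_RInt (fun t => Re (f t)) a b (Re I) -> is_RInt (fun t => Im (f t)) a b (Im I) ->
  is_RInt_C f a b I.
Proof.
  intros Hr Hi. destruct I as [I1 I2].
  exact (is_RInt_fct_extend_pair (U := R_NormedModule) (V := R_NormedModule) f a b I1 I2 Hr Hi).
Qed.

Lemma is_RInt_C_Re (f : R -> C) (a b : R) (I : C) :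
  is_RInt_C f a b I -> is_RInt (fun t => Re (f t)) a b (Re I).
Proof. exact (is_RInt_fct_extend_fst (U := R_NormedModule) (V := R_NormedModule) f a b I). Qed.

Lemma is_RInt_C_Im (f : R -> C) (a b : R) (I : C) :
  is_RInt_C f a b I -> is_RInt (fun t => Im (f t)) a b (Im I).
Proof. exact (is_RInt_fct_extend_snd (U := R_NormedModule) (V := R_NormedModule) f a b I). Qed.

Lemma is_RInt_C_plus (f g : R -> C) (a b : R) (I J : C) :
  is_RInt_C f a b I -> is_RInt_C g a b J -> is_RInt_C (fun t => f t + g t) a b (I + J).
Proof. apply (is_RInt_plus (V := C_R_NormedModule)). Qed.

Lemma is_RInt_C_minus (f g : R -> C) (a b : R) (I J : C) :
  is_RInt_C f a b I -> is_RInt_C g a b J -> is_RInt_C (fun t => f t - g t) a b (I - J).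
Proof. apply (is_RInt_minus (V := C_R_NormedModule)). Qed.

Lemma is_RInt_C_scal (f : R -> C) (a b : R) (c I : C) :
  is_RInt_C f a b I -> is_RInt_C (fun t => c * f t) a b (c * I).
Proof.
  intros H. pose proof (is_RInt_C_Re _ _ _ _ H) as H1. pose proof (is_RInt_C_Im _ _ _ _ H) as H2.
  apply is_RInt_C_parts; simpl.
  - apply (is_RInt_minus (V := R_NormedModule) (fun t => fst c * Re (f t))%R
      (fun t => snd c * Im (f t))%R); apply (is_RInt_scal (V := R_NormedModule)); trivial.
  - apply (is_RInt_plus (V := R_NormedModule) (fun t => fst c * Im (f t))%R
      (fun t => snd c * Re (f t))%R); apply (is_RInt_scal (V := R_NormedModule)); trivial.
Qed.

Lemma is_RInt_C_unique (f : R -> C) (a b : R) (I : C) : is_RInt_C f a b I -> RInt_C f a b = I.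
Proof. exact (is_RInt_unique (V := C_R_CompleteNormedModule) f a b I). Qed.

Lemma is_RInt_C_continuous (f : R -> C) (a b : R) :
  (forall t, (Rmin a b <= t <= Rmax a b)%R -> continuous f t) -> is_RInt_C f a b (RInt_C f a b).
Proof.
  intros H. apply (RInt_correct (V := C_R_CompleteNormedModule)).
  now apply (ex_RInt_continuous (V := C_R_CompleteNormedModule)).
Qed.

Lemma is_RInt_C_derive (f df : R -> C) (a b : R) :
  (forall t, (Rmin a b <= t <= Rmax a b)%R -> is_derive_C f t (df t)) ->
  (forall t, (Rmin a b <= t <= Rmax a b)%R -> continuous df t) ->
  is_RInt_C df a b (f b - f a).
Proof. exact (is_RInt_derive (V := C_R_CompleteNormedModule) f df a b). Qed.

(** The real Leibniz rule on real and imaginary parts.  The hypotheses bear on a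
    neighbourhood [U] of the segment of integration only, since the integrands to come are
    regular only on part of the plane. *)
Lemma is_derive_C_RInt_param (f df : R -> R -> C) (a b t : R) (U : R * R -> Prop) :
  (forall p, U p -> is_derive_C (fun x => f x (snd p)) (fst p) (df (fst p) (snd p))) ->
  (forall p, U p -> continuous (fun r : R * R => f (fst r) (snd r)) p) ->
  (forall p, U p -> continuous (fun r : R * R => df (fst r) (snd r)) p) ->
  (forall s, (Rmin a b <= s <= Rmax a b)%R -> locally (t, s) U) ->
  locally t (fun x => forall s, (Rmin a b <= s <= Rmax a b)%R -> U (x, s)) ->
  is_derive_C (fun x => RInt_C (f x) a b) t (RInt_C (df t) a b).
Proof.
  intros Hd Hf Hdf HU Ht.
  assert (Hpair : forall (h : R -> R -> C) (x s : R),
    continuous (fun r : R * R => h (fst r) (snd r)) (x, s) -> continuous (h x) s).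
  { intros h x s H.
    apply (continuous_comp_2 (fun _ : R => x) (fun s : R => s) h);
      [apply continuous_const | apply continuous_id | exact H]. }
  assert (Hint : forall x, (forall s, (Rmin a b <= s <= Rmax a b)%R -> U (x, s)) ->
    is_RInt_C (f x) a b (RInt_C (f x) a b)).
  { intros x H. apply is_RInt_C_continuous. intros s Hs.
    apply Hpair, Hf, H, Hs. }
  assert (HUt := locally_singleton _ _ Ht). simpl in HUt.
  assert (Hdint : is_RInt_C (df t) a b (RInt_C (df t) a b)).
  { apply is_RInt_C_continuous. intros s Hs. apply Hpair, Hdf, HUt, Hs. }
  (* The real Leibniz rule, for a part [pr] of [f]. *)
  assert (L : forall pr : C -> R,
    (forall w x d, is_derive_C w x d -> is_derive (fun s => pr (w s)) x (pr d)) ->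
    (forall (w : R * R -> C) p, continuous w p -> continuous (fun r => pr (w r)) p) ->
    (forall g I, is_RInt_C g a b I -> is_RInt (fun s => pr (g s)) a b (pr I)) ->
    is_derive (fun x => pr (RInt_C (f x) a b)) t (pr (RInt_C (df t) a b))).
  { intros pr Pd Pc Pi.
    apply (is_derive_ext_loc (fun x => RInt (fun s => pr (f x s)) a b)).
    { revert Ht. apply filter_imp. intros x Hx. apply is_RInt_unique, Pi, Hint, Hx. }
    assert (D : forall p, U p -> Derive (fun x => pr (f x (snd p))) (fst p) = pr (df (fst p) (snd p))).
    { intros p Hp. apply is_derive_unique, (Pd (fun x => f x (snd p))), Hd, Hp. }
    evar_last.
    - apply is_derive_RInt_param.
      + revert Ht. apply filter_imp. intros x Hx s Hs. exists (pr (df x s)).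
        apply (Pd (fun x => f x s)), (Hd (x, s)), Hx, Hs.
      + intros s Hs. apply continuity_2d_pt_filterlim.
        assert (K : continuous (U := R_UniformSpace)
          (fun r : R * R => Derive (fun z => pr (f z (snd r))) (fst r)) (t, s)).
        { apply (continuous_ext_loc (U := R_UniformSpace)  _
                 (fun r : R * R => pr (df (fst r) (snd r)))).
        * generalize (HU s Hs). apply filter_imp. intros r Hr. symmetry. now apply D.
        * apply Pc, Hdf, HUt, Hs. }
        exact K.
      + revert Ht. apply filter_imp. intros x Hx. exists (pr (RInt_C (f x) a b)).
        apply Pi, Hint, Hx.
    - simpl. apply is_RInt_unique.
      apply (is_RInt_ext (fun s => pr (df t s))).
      + intros s Hs. symmetry. apply (D (t, s)), HUt. lra.
      + apply Pi, Hdint. }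
  apply is_derive_C_parts; apply L; auto using is_derive_C_Re, is_derive_C_Im,
    is_RInt_C_Re, is_RInt_C_Im; intros; [now apply continuous_Re | now apply continuous_Im].
Qed.

(** Complex differentiability is used only through the chain rule along real curves,
    so this rule is taken as the definition; it makes the closure properties below
    immediate consequences of the rules for one real variable. *)
Definition curve_derivative (k : C -> C) (z l : C) : Prop :=
  forall (w : R -> C) (t : R) (dw : C),
    w t = z -> is_derive_C w t dw -> is_derive_C (fun s => k (w s)) t (l * dw).

Definition C1_holomorphic (D : C -> Prop) (k : C -> C) : Prop :=
  exists dk : C -> C, forall z, D z ->
    curve_derivative k z (dk z) /\ continuous k z /\ continuous dk z.

Lemma C1_holomorphic_sub (D E : C -> Prop) (k : C -> C) :
  (forall z, E z -> D z) -> C1_holomorphic D k -> C1_holomorphic E k.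
Proof. intros H [dk Hk]. exists dk. auto. Qed.

Lemma C1_holomorphic_const (D : C -> Prop) (c : C) : C1_holomorphic D (fun _ => c).
Proof.
  exists (fun _ => RtoC 0). intros z _.
  split; [|split; apply continuous_const].
  intros w t dw _ _. rewrite Cmult_0_l. apply is_derive_C_const.
Qed.

Lemma C1_holomorphic_id (D : C -> Prop) : C1_holomorphic D (fun z => z).
Proof.
  exists (fun _ => RtoC 1). intros z _.
  split; [|split; [apply continuous_id | apply continuous_const]].
  intros w t dw _ H. now rewrite Cmult_1_l.
Qed.

Lemma C1_holomorphic_plus (D : C -> Prop) (k h : C -> C) :
  C1_holomorphic D k -> C1_holomorphic D h -> C1_holomorphic D (fun z => k z + h z).
Proof.
  intros [dk Hk] [dh Hh]. exists (fun z => dk z + dh z). intros z Hz.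
  destruct (Hk z Hz) as (K1 & K2 & K3), (Hh z Hz) as (H1 & H2 & H3).
  split; [|split; now apply continuous_Cplus].
  intros w t dw Hw Hd. rewrite Cmult_plus_distr_r. apply is_derive_C_plus; auto.
Qed.

Lemma C1_holomorphic_mult (D : C -> Prop) (k h : C -> C) :
  C1_holomorphic D k -> C1_holomorphic D h -> C1_holomorphic D (fun z => k z * h z).
Proof.
  intros [dk Hk] [dh Hh]. exists (fun z => dk z * h z + k z * dh z). intros z Hz.
  destruct (Hk z Hz) as (K1 & K2 & K3), (Hh z Hz) as (H1 & H2 & H3).
  split; [|split; [now apply continuous_Cmult
                  | apply continuous_Cplus; now apply continuous_Cmult]].
  intros w t dw Hw Hd.
  replace ((dk z * h z + k z * dh z) * dw)
    with ((dk z * dw) * h (w t) + k (w t) * (dh z * dw)) by (rewrite Hw; ring).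
  apply (is_derive_C_mult (fun s => k (w s)) (fun s => h (w s))); auto.
Qed.

Lemma C1_holomorphic_inv (D : C -> Prop) (k : C -> C) :
  C1_holomorphic D k -> (forall z, D z -> k z <> 0) -> C1_holomorphic D (fun z => / k z).
Proof.
  intros [dk Hk] H0. exists (fun z => - dk z * (/ k z * / k z)). intros z Hz.
  destruct (Hk z Hz) as (K1 & K2 & K3). specialize (H0 z Hz).
  split; [|split].
  - intros w t dw Hw Hd.
    replace (- dk z * (/ k z * / k z) * dw)
      with (- (dk z * dw) / (k (w t) * k (w t))) by (rewrite Hw; field; trivial).
    apply (is_derive_C_inv (fun s => k (w s))); auto. now rewrite Hw.
  - now apply continuous_Cinv.
  - apply continuous_Cmult; [now apply continuous_Copp|].
    apply continuous_Cmult; now apply continuous_Cinv.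
Qed.

Lemma C1_holomorphic_exp (D : C -> Prop) (k : C -> C) :
  C1_holomorphic D k -> C1_holomorphic D (fun z => Cexp (k z)).
Proof.
  intros [dk Hk]. exists (fun z => Cexp (k z) * dk z). intros z Hz.
  destruct (Hk z Hz) as (K1 & K2 & K3).
  split; [|split].
  - intros w t dw Hw Hd. rewrite <- Cmult_assoc, <- Hw at 1.
    apply (is_derive_C_exp (fun s => k (w s))); auto.
  - now apply continuous_Cexp.
  - apply continuous_Cmult; [now apply continuous_Cexp | trivial].
Qed.

Lemma C1_holomorphic_pow (D : C -> Prop) (k : C -> C) (n : nat) :
  C1_holomorphic D k -> C1_holomorphic D (fun z => k z ^ n).
Proof.
  intros H. induction n as [|n IH]; simpl.
  - apply C1_holomorphic_const.
  - now apply C1_holomorphic_mult.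
Qed.

(** * Line integrals along piecewise continuously differentiable paths *)

Definition C1_curve (x dx : R -> C) : Prop :=
  (forall t, is_derive_C x t (dx t)) /\ (forall t, continuous dx t).

Lemma is_derive_C_continuous (x : R -> C) (t : R) (d : C) : is_derive_C x t d -> continuous x t.
Proof.
  intros H.
  apply (ex_derive_continuous (K := R_AbsRing) (V := C_R_NormedModule)). now exists d.
Qed.

Lemma is_derive_C_unique (x : R -> C) (t : R) (d e : C) :
  is_derive_C x t d -> is_derive_C x t e -> d = e.
Proof.
  intros Hd He.
  pose proof (is_derive_unique _ _ _ (is_derive_C_Re _ _ _ Hd)) as H1.
  pose proof (is_derive_unique _ _ _ (is_derive_C_Im _ _ _ Hd)) as H2.
  rewrite (is_derive_unique _ _ _ (is_derive_C_Re _ _ _ He)) in H1.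
  rewrite (is_derive_unique _ _ _ (is_derive_C_Im _ _ _ He)) in H2.
  destruct d, e. unfold Re, Im in *; simpl in *. now subst.
Qed.

Lemma is_derive_C_velocity (x : R -> C) (t : R) (d : C) : is_derive_C x t d -> velocity x t = d.
Proof.
  intros H. unfold velocity.
  pose proof (is_derive_unique _ _ _ (is_derive_C_Re _ _ _ H)) as H1.
  pose proof (is_derive_unique _ _ _ (is_derive_C_Im _ _ _ H)) as H2.
  destruct d as [d1 d2]. exact (f_equal2 (@pair R R) H1 H2).
Qed.

(** A path of class C^1 on [[a, b]] extends to the whole line, so end points need no
    one-sided derivatives. *)
Lemma C1_on_curves (g : R -> C * C) (a b : R) :
  C1_on g a b -> exists x y dx dy : R -> C, C1_curve x dx /\ C1_curve y dy /\
    forall t, (a <= t <= b)%R -> g t = (x t, y t).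
Proof.
  intros (h & dh & Hd & Hc & Hg).
  exists (fun t => fst (h t)), (fun t => snd (h t)), (fun t => fst (dh t)), (fun t => snd (dh t)).
  split; [split | split; [split |]].
  - intros t.
    apply (filterdiff_ext_lin _ (fun y : R => fst (scal (V := prod_NormedModule R_AbsRing
      C_R_NormedModule C_R_NormedModule) y (dh t))));
      [|now intros y].
    apply (filterdiff_comp' (V := prod_NormedModule R_AbsRing C_R_NormedModule C_R_NormedModule)
      (W := C_R_NormedModule) h (fun z => fst z) t _ (fun z => fst z) (Hd t)).
    apply filterdiff_linear, (is_linear_fst (U := C_R_NormedModule) (V := C_R_NormedModule)).
  - intros t. apply (continuous_comp dh (fun z => fst z)); [apply Hc | apply continuous_fst].
  - intros t.
    apply (filterdiff_ext_lin _ (fun y : R => snd (scal (V := prod_NormedModule R_AbsRing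
      C_R_NormedModule C_R_NormedModule) y (dh t))));
      [|now intros y].
    apply (filterdiff_comp' (V := prod_NormedModule R_AbsRing C_R_NormedModule C_R_NormedModule)
      (W := C_R_NormedModule) h (fun z => snd z) t _ (fun z => snd z) (Hd t)).
    apply filterdiff_linear, (is_linear_snd (U := C_R_NormedModule) (V := C_R_NormedModule)).
  - intros t. apply (continuous_comp dh (fun z => snd z)); [apply Hc | apply continuous_snd].
  - intros t Ht. rewrite (Hg t Ht). apply surjective_pairing.
Qed.

Definition eval_form (w : one_form) (p X : C * C) : C :=
  du_coef w p * fst X + dv_coef w p * snd X.

Definition pullback (w : one_form) (g : R -> C * C) (t : R) : C :=
  eval_form w (g t) (velocity (fun s => fst (g s)) t, velocity (fun s => snd (g s)) t).

Notation is_line_integral w g a b I := (is_RInt_C (pullback w g) a b I).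

(** Only the open interval is covered: at [a] and [b] the path [g] need not be
    differentiable, which integrals do not see. *)
Lemma pullback_C1 (w : one_form) (g : R -> C * C) (a b : R) (x y dx dy : R -> C) :
  C1_curve x dx -> C1_curve y dy -> (forall t, (a <= t <= b)%R -> g t = (x t, y t)) ->
  forall t, (a < t < b)%R -> pullback w g t = eval_form w (x t, y t) (dx t, dy t).
Proof.
  intros [Hx _] [Hy _] Hg t Ht. unfold pullback. rewrite Hg by lra.
  assert (L : locally t (fun s => (x s, y s) = g s)).
  { apply (locally_interval _ t a b); simpl; try lra.
    intros s H1 H2. symmetry. apply Hg. lra. }
  f_equal. f_equal; apply is_derive_C_velocity.
  - apply (is_derive_ext_loc (K := R_AbsRing) (V := C_R_NormedModule) x); [|apply Hx].
    revert L. apply filter_imp. intros s Hs. now rewrite <- Hs.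
  - apply (is_derive_ext_loc (K := R_AbsRing) (V := C_R_NormedModule) y); [|apply Hy].
    revert L. apply filter_imp. intros s Hs. now rewrite <- Hs.
Qed.

Definition one_form_minus (w1 w2 : one_form) : one_form :=
  OneForm (fun p => du_coef w1 p - du_coef w2 p) (fun p => dv_coef w1 p - dv_coef w2 p).

Lemma eval_form_minus (w1 w2 : one_form) (p X : C * C) :
  eval_form (one_form_minus w1 w2) p X = eval_form w1 p X - eval_form w2 p X.
Proof. unfold eval_form; simpl. ring. Qed.

Lemma line_integral_minus (w1 w2 : one_form) (g : R -> C * C) (a b : R) (I J : C) :
  is_line_integral w1 g a b I -> is_line_integral w2 g a b J ->
  is_line_integral (one_form_minus w1 w2) g a b (I - J).
Proof.
  intros HI HJ.
  apply (is_RInt_ext (V := C_R_NormedModule)) with (2 := is_RInt_C_minus _ _ _ _ _ _ HI HJ).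
  intros t _. symmetry. apply eval_form_minus.
Qed.

Lemma piecewise_C1_lt (g : R -> C * C) (a b : R) : piecewise_C1 g a b -> (a < b)%R.
Proof. induction 1; lra. Qed.

Lemma is_line_integral_C1 (w : one_form) (g : R -> C * C) (a b : R) (x y dx dy : R -> C) (I : C) :
  (a < b)%R ->
  C1_curve x dx -> C1_curve y dy -> (forall t, (a <= t <= b)%R -> g t = (x t, y t)) ->
  is_RInt_C (fun t => eval_form w (x t, y t) (dx t, dy t)) a b I -> is_line_integral w g a b I.
Proof.
  intros Hab Hx Hy Hg.
  apply (is_RInt_ext (V := C_R_NormedModule)).
  intros t. rewrite Rmin_left, Rmax_right by lra. intros Ht. symmetry.
  exact (pullback_C1 w g a b x y dx dy Hx Hy Hg t Ht).
Qed.

Lemma is_line_integral_cat (w : one_form) (g : R -> C * C) (a b c : R) (I J : C) :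
  is_line_integral w g a b I -> is_line_integral w g b c J -> is_line_integral w g a c (I + J).
Proof. apply (is_RInt_Chasles (V := C_R_NormedModule)). Qed.

Lemma is_line_integral_split (w : one_form) (g : R -> C * C) (a b c : R) (I : C) :
  (a <= b <= c)%R -> is_line_integral w g a c I ->
  exists I1 I2, is_line_integral w g a b I1 /\ is_line_integral w g b c I2 /\ I = I1 + I2.
Proof.
  intros Hb H.
  assert (E : ex_RInt (V := C_R_CompleteNormedModule) (pullback w g) a c) by now exists I.
  destruct (ex_RInt_Chasles_1 (V := C_R_CompleteNormedModule) _ a b c Hb E) as [I1 H1].
  destruct (ex_RInt_Chasles_2 (V := C_R_CompleteNormedModule) _ a b c Hb E) as [I2 H2].
  exists I1, I2. repeat split; trivial.
  rewrite <- (is_RInt_C_unique _ _ _ _ H).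
  apply (is_RInt_C_unique (pullback w g) a c (I1 + I2)).
  now apply is_line_integral_cat with b.
Qed.

Lemma C1_curve_continuous_form (w : one_form) (x y dx dy : R -> C) (t : R) :
  C1_curve x dx -> C1_curve y dy ->
  continuous (du_coef w) (x t, y t) -> continuous (dv_coef w) (x t, y t) ->
  continuous (fun s => eval_form w (x s, y s) (dx s, dy s)) t.
Proof.
  intros [Hx Cx] [Hy Cy] Hu Hv.
  assert (E : forall P : C * C -> C, continuous P (x t, y t) -> continuous (fun s => P (x s, y s)) t).
  { intros P HP.
    apply (continuous_comp_2 x y (fun z z' => P (z, z'))).
    - exact (is_derive_C_continuous _ _ _ (Hx t)).
    - exact (is_derive_C_continuous _ _ _ (Hy t)).
    - apply (continuous_ext P); [now intros []|exact HP]. }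
  apply continuous_Cplus; apply continuous_Cmult; trivial; apply E; trivial.
Qed.

Lemma line_integral_exists (w : one_form) (g : R -> C * C) (a b : R) :
  piecewise_C1 g a b ->
  (forall t, (a <= t <= b)%R ->
    continuous (du_coef w) (g t) /\ continuous (dv_coef w) (g t)) ->
  exists I, is_line_integral w g a b I.
Proof.
  induction 1 as [a b Hab Hg | a b c H1 IH1 H2 IH2]; intros Hc.
  - destruct (C1_on_curves g a b Hg) as (x & y & dx & dy & Hx & Hy & E).
    eexists. apply (is_line_integral_C1 w g a b x y dx dy); trivial.
    apply is_RInt_C_continuous.
    rewrite Rmin_left, Rmax_right by lra. intros t Ht.
    destruct (Hc t Ht) as [Hu Hv]. rewrite (E t Ht) in Hu, Hv.
    now apply C1_curve_continuous_form.
  - apply piecewise_C1_lt in H1, H2.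
    destruct IH1 as [I HI]; [intros t Ht; apply Hc; lra|].
    destruct IH2 as [J HJ]; [intros t Ht; apply Hc; lra|].
    exists (I + J). now apply is_line_integral_cat with b.
Qed.

(** A primitive of [w] at the points of [S].  Differentiability is asked along
    C^1 curves only, because the primitives of interest are integrals depending on a
    parameter, whose derivative is computed by the Leibniz rule. *)
Definition potential (S : C * C -> Prop) (w : one_form) (Phi : C * C -> C) : Prop :=
  forall x y dx dy : R -> C, C1_curve x dx -> C1_curve y dy ->
  forall t, S (x t, y t) ->
    is_derive_C (fun s => Phi (x s, y s)) t (eval_form w (x t, y t) (dx t, dy t)).

Lemma line_integral_potential (S : C * C -> Prop) (w : one_form) (Phi : C * C -> C)
    (g : R -> C * C) (a b : R) :
  potential S w Phi ->
  (forall p, S p -> continuous (du_coef w) p /\ continuous (dv_coef w) p) ->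
  piecewise_C1 g a b -> (forall t, (a <= t <= b)%R -> S (g t)) ->
  is_line_integral w g a b (Phi (g b) - Phi (g a)).
Proof.
  intros HPhi Hc. induction 1 as [a b Hab Hg | a b c H1 IH1 H2 IH2]; intros HS.
  - destruct (C1_on_curves g a b Hg) as (x & y & dx & dy & Hx & Hy & E).
    apply (is_line_integral_C1 w g a b x y dx dy); trivial.
    rewrite (E a), (E b) by lra.
    apply (is_RInt_C_derive (fun t => Phi (x t, y t)));
      rewrite Rmin_left, Rmax_right by lra; intros t Ht;
      specialize (HS t Ht); rewrite (E t Ht) in HS.
    + now apply HPhi.
    + destruct (Hc _ HS). now apply C1_curve_continuous_form.
  - pose proof (piecewise_C1_lt _ _ _ H1). pose proof (piecewise_C1_lt _ _ _ H2).
    replace (Phi (g c) - Phi (g a)) with ((Phi (g b) - Phi (g a)) + (Phi (g c) - Phi (g b))) by ring.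
    apply is_line_integral_cat with b; [apply IH1 | apply IH2]; intros t Ht; apply HS; lra.
Qed.

(** Along a path in [Chat e1 e2] the velocity is tangent, as one sees by
    differentiating the defining equation. *)
Lemma line_integral_tangent_ext (e1 e2 : Sign) (w1 w2 : one_form) (g : R -> C * C) (a b : R) (I : C) :
  (forall p X, Chat e1 e2 p -> tangent_Chat e1 e2 p X -> eval_form w1 p X = eval_form w2 p X) ->
  piecewise_C1 g a b -> (forall t, (a <= t <= b)%R -> Chat e1 e2 (g t)) ->
  is_line_integral w1 g a b I -> is_line_integral w2 g a b I.
Proof.
  intros Hw H. revert I.
  induction H as [a b Hab Hg | a b c H1 IH1 H2 IH2]; intros I HS.
  - destruct (C1_on_curves g a b Hg) as (x & y & dx & dy & Hx & Hy & E).
    apply (is_RInt_ext (V := C_R_NormedModule)).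
    rewrite Rmin_left, Rmax_right by lra. intros t Ht.
    rewrite !(pullback_C1 _ g a b x y dx dy Hx Hy E t Ht).
    assert (Ht' : (a <= t <= b)%R) by lra.
    pose proof (HS t Ht') as St. rewrite (E t Ht') in St.
    apply Hw; trivial. unfold tangent_Chat; simpl.
    apply (is_derive_C_unique (fun s => sgn e1 * Cexp (x s) + sgn e2 * Cexp (y s)) t).
    + rewrite <- !Cmult_assoc.
      assert (T : forall (e : C) (z dz : R -> C), C1_curve z dz ->
        is_derive_C (fun s => e * Cexp (z s)) t (e * (Cexp (z t) * dz t))).
      { intros e z dz [Hz _].
        replace (e * (Cexp (z t) * dz t)) with (0 * Cexp (z t) + e * (Cexp (z t) * dz t)) by ring.
        apply (is_derive_C_mult (fun _ => e) (fun s => Cexp (z s)));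
          [apply is_derive_C_const | apply is_derive_C_exp, Hz]. }
      apply (is_derive_C_plus (fun s => sgn e1 * Cexp (x s)) (fun s => sgn e2 * Cexp (y s)));
        now apply T.
    + apply (is_derive_ext_loc (K := R_AbsRing) (V := C_R_NormedModule) (fun _ => RtoC 1));
        [|apply is_derive_C_const].
      apply (locally_interval _ t a b); simpl; try lra.
      intros s Hs1 Hs2. assert (Hs : (a <= s <= b)%R) by lra.
      pose proof (HS s Hs) as Ss. rewrite (E s Hs) in Ss. symmetry. exact Ss.
  - pose proof (piecewise_C1_lt _ _ _ H1). pose proof (piecewise_C1_lt _ _ _ H2).
    intros HI. destruct (is_line_integral_split w1 g a b c I) as (I1 & I2 & J1 & J2 & ->);
      [lra | trivial |].
    apply is_line_integral_cat with b; [apply IH1 | apply IH2]; trivial;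
      intros t Ht; apply HS; lra.
Qed.

Lemma piecewise_C1_bounded (F : C * C -> R) (g : R -> C * C) (a b : R) :
  piecewise_C1 g a b -> (forall t, (a <= t <= b)%R -> continuous F (g t)) ->
  exists B, forall t, (a <= t <= b)%R -> (F (g t) <= B)%R.
Proof.
  induction 1 as [a b Hab Hg | a b c H1 IH1 H2 IH2]; intros HF.
  - destruct (C1_on_curves g a b Hg) as (x & y & dx & dy & Hx & Hy & E).
    destruct (bounded_continuity (K := R_AbsRing) (V := R_NormedModule)
      (fun t => F (x t, y t)) a b) as [B HB].
    { intros t Ht. pose proof (HF t Ht) as Ft. rewrite (E t Ht) in Ft.
      apply (continuous_comp_2 x y (fun z z' => F (z, z'))).
      - exact (is_derive_C_continuous _ _ _ (proj1 Hx t)).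
      - exact (is_derive_C_continuous _ _ _ (proj1 Hy t)).
      - apply (continuous_ext F); [now intros []|exact Ft]. }
    exists B. intros t Ht. rewrite (E t Ht). left.
    apply Rle_lt_trans with (2 := HB t Ht). apply Rle_abs.
  - pose proof (piecewise_C1_lt _ _ _ H1). pose proof (piecewise_C1_lt _ _ _ H2).
    destruct IH1 as [B1 HB1]; [intros t Ht; apply HF; lra|].
    destruct IH2 as [B2 HB2]; [intros t Ht; apply HF; lra|].
    exists (Rmax B1 B2). intros t Ht.
    destruct (Rle_dec t b).
    + apply Rle_trans with (2 := Rmax_l _ _). apply HB1; lra.
    + apply Rle_trans with (2 := Rmax_r _ _). apply HB2; lra.
Qed.

Definition du_form (k : C -> C) : one_form := OneForm (fun p => k (fst p)) (fun _ => RtoC 0).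

(** [L] plays the part of the length of the projection of the path to the [u]-plane; it
    makes line integrals continuous in the form. *)
Lemma piecewise_C1_length (g : R -> C * C) (a b : R) :
  piecewise_C1 g a b ->
  exists L, (0 <= L)%R /\ forall k e I, (0 <= e)%R ->
    (forall t, (a <= t <= b)%R -> (Cmod (k (fst (g t))) <= e)%R) ->
    is_line_integral (du_form k) g a b I -> (Cmod I <= e * L)%R.
Proof.
  induction 1 as [a b Hab Hg | a b c H1 IH1 H2 IH2].
  - destruct (C1_on_curves g a b Hg) as (x & y & dx & dy & Hx & Hy & E).
    destruct (bounded_continuity (K := R_AbsRing) (V := C_R_NormedModule) dx a b) as [B HB].
    { intros t Ht. apply (proj2 Hx). }
    assert (B0 : (0 <= B)%R).
    { apply Rle_trans with (norm (V := C_R_NormedModule) (dx a)); [apply norm_ge_0|].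
      left. apply HB. lra. }
    exists ((b - a) * B)%R. split; [apply Rmult_le_pos; lra|].
    intros k e I He Hk HI.
    rewrite <- norm_C_R.
    apply (norm_RInt_le (V := C_R_NormedModule)
      (fun t => eval_form (du_form k) (x t, y t) (dx t, dy t)) (fun _ => (e * B)%R) a b); [lra| | |].
    + intros t Ht. rewrite norm_C_R. unfold eval_form; simpl.
      rewrite Cmult_0_l, Cplus_0_r, Cmod_mult.
      apply Rmult_le_compat; try apply Cmod_ge_0.
      * specialize (Hk t Ht). now rewrite (E t Ht) in Hk.
      * left. rewrite <- norm_C_R. now apply HB.
    + apply (is_RInt_ext (V := C_R_NormedModule)) with (2 := HI).
      rewrite Rmin_left, Rmax_right by lra. intros t Ht.
      now apply pullback_C1 with a b.
    + evar_last; [apply is_RInt_const|]. unfold scal; simpl; unfold mult; simpl. ring.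
  - pose proof (piecewise_C1_lt _ _ _ H1). pose proof (piecewise_C1_lt _ _ _ H2).
    destruct IH1 as (L1 & L1p & HL1), IH2 as (L2 & L2p & HL2).
    exists (L1 + L2)%R. split; [lra|]. intros k e I He Hk HI.
    destruct (is_line_integral_split (du_form k) g a b c I) as (I1 & I2 & J1 & J2 & ->);
      [lra | trivial |].
    apply Rle_trans with (1 := Cmod_triangle _ _). rewrite Rmult_plus_distr_l.
    apply Rplus_le_compat; [apply (HL1 k) | apply (HL2 k)]; trivial; intros t Ht; apply Hk; lra.
Qed.

(** * The complex exponential and winding numbers *)

Lemma Cexp_plus (z w : C) : Cexp (z + w) = Cexp z * Cexp w.
Proof.
  unfold Cexp; simpl. rewrite exp_plus, cos_plus, sin_plus.
  apply injective_projections; simpl; unfold Re, Im; ring.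
Qed.

Lemma Cexp_0 : Cexp 0 = 1.
Proof. unfold Cexp; simpl. rewrite exp_0, cos_0, sin_0. apply injective_projections; simpl; ring. Qed.

Lemma Cexp_neq_0 (z : C) : Cexp z <> 0.
Proof.
  intros H. apply C1_nz. rewrite <- Cexp_0. replace (RtoC 0) with (z + - z) by ring.
  rewrite Cexp_plus, H. ring.
Qed.

Lemma Cexp_eq_1 (z : C) : Cexp z = 1 <-> exists k : Z, z = RtoC (IZR k) * (RtoC 2 * RtoC PI * Ci).
Proof.
  split.
  - destruct z as [x y]. unfold Cexp; simpl. intros H. injection H as H1 H2.
    pose proof (exp_pos x). pose proof (sin2_cos2 y) as T. unfold Rsqr in T.
    assert (Sy : sin y = 0%R) by nra.
    assert (Cy : cos y = 1%R) by nra.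
    assert (x = 0%R).
    { rewrite Cy, Rmult_1_r in H1. rewrite <- exp_0 in H1. now apply exp_inv. }
    assert (S2 : sin (y / 2) = 0%R).
    { pose proof (cos_2a_sin (y / 2)) as E. replace (2 * (y / 2))%R with y in E by field. nra. }
    destruct (sin_eq_0_0 _ S2) as [k Hk]. exists k. subst x.
    apply injective_projections; simpl; [ring|].
    replace y with (2 * (y / 2))%R by field. rewrite Hk. ring.
  - intros [k ->].
    assert (S : sin (IZR k * PI) = 0%R) by (apply sin_eq_0_1; now exists k).
    replace (RtoC (IZR k) * (RtoC 2 * RtoC PI * Ci)) with ((0, 2 * (IZR k * PI))%R : C)
      by (apply injective_projections; simpl; ring).
    unfold Cexp; simpl. rewrite exp_0, cos_2a_sin, sin_2a, S.
    apply injective_projections; simpl; ring.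
Qed.

Lemma continuous_fst_C (p : C * C) : continuous (fun p : C * C => fst p) p.
Proof. apply continuous_fst. Qed.

Lemma continuous_du_form (D : C -> Prop) (k : C -> C) (p : C * C) :
  C1_holomorphic D k -> D (fst p) ->
  continuous (du_coef (du_form k)) p /\ continuous (dv_coef (du_form k)) p.
Proof.
  intros [dk Hk] Hp. split.
  - apply (continuous_comp (fun p : C * C => fst p) k); [apply continuous_fst_C | now apply Hk].
  - apply continuous_const.
Qed.

Lemma du_form_integral_exists (D : C -> Prop) (k : C -> C) (g : R -> C * C) (a b : R) :
  C1_holomorphic D k -> piecewise_C1 g a b -> (forall t, (a <= t <= b)%R -> D (fst (g t))) ->
  exists I, is_line_integral (du_form k) g a b I.
Proof.
  intros Hk Hg HD. apply line_integral_exists; trivial.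
  intros t Ht. apply (continuous_du_form D); auto.
Qed.

Lemma du_form_integral_ext (k h : C -> C) (g : R -> C * C) (a b : R) (I : C) :
  piecewise_C1 g a b -> (forall t, (a <= t <= b)%R -> k (fst (g t)) = h (fst (g t))) ->
  is_line_integral (du_form k) g a b I -> is_line_integral (du_form h) g a b I.
Proof.
  intros Hg E. pose proof (piecewise_C1_lt _ _ _ Hg).
  apply (is_RInt_ext (V := C_R_NormedModule)). rewrite Rmin_left, Rmax_right by lra.
  intros t Ht. unfold pullback, eval_form; simpl. rewrite E by lra. reflexivity.
Qed.

Lemma du_form_integral_plus (k h : C -> C) (g : R -> C * C) (a b : R) (I J : C) :
  is_line_integral (du_form k) g a b I -> is_line_integral (du_form h) g a b J ->
  is_line_integral (du_form (fun u => k u + h u)) g a b (I + J).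
Proof.
  intros HI HJ. apply (is_RInt_ext (V := C_R_NormedModule))
    with (2 := is_RInt_C_plus _ _ _ _ _ _ HI HJ).
  intros t _. unfold pullback, eval_form; simpl. ring.
Qed.

Lemma du_form_integral_scal (c : C) (k : C -> C) (g : R -> C * C) (a b : R) (I : C) :
  is_line_integral (du_form k) g a b I ->
  is_line_integral (du_form (fun u => c * k u)) g a b (c * I).
Proof.
  intros HI. apply (is_RInt_ext (V := C_R_NormedModule))
    with (2 := is_RInt_C_scal _ _ _ c _ HI).
  intros t _. unfold pullback, eval_form; simpl. ring.
Qed.

Lemma du_form_integral_minus (k h : C -> C) (g : R -> C * C) (a b : R) (I J : C) :
  is_line_integral (du_form k) g a b I -> is_line_integral (du_form h) g a b J ->
  is_line_integral (du_form (fun u => k u - h u)) g a b (I - J).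
Proof.
  intros HI HJ. apply (is_RInt_ext (V := C_R_NormedModule))
    with (2 := is_RInt_C_minus _ _ _ _ _ _ HI HJ).
  intros t _. unfold pullback, eval_form; simpl. ring.
Qed.

Lemma line_integral_unique (w : one_form) (g : R -> C * C) (a b : R) (I J : C) :
  is_line_integral w g a b I -> is_line_integral w g a b J -> I = J.
Proof.
  intros HI HJ. rewrite <- (is_RInt_C_unique _ _ _ _ HI). exact (is_RInt_C_unique _ _ _ _ HJ).
Qed.

(** If [L t] is the integral of [du / (u - al)] up to time [t], the function
    [exp (- L t) (u t - al)] has derivative zero.  This avoids choosing branches of the
    logarithm. *)
Lemma exp_integral_dlog (al : C) (g : R -> C * C) (a b : R) (I : C) :
  piecewise_C1 g a b -> (forall t, (a <= t <= b)%R -> fst (g t) <> al) ->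
  is_line_integral (du_form (fun u => / (u - al))) g a b I ->
  Cexp I * (fst (g a) - al) = fst (g b) - al.
Proof.
  intros Hg. revert I. induction Hg as [a b Hab Hg | a b c H1 IH1 H2 IH2]; intros I Hal HI.
  - destruct (C1_on_curves g a b Hg) as (x & y & dx & dy & [Hx Cx] & Hy & E).
    rewrite (E a), (E b) by lra. simpl.
    (* Clamping to [[a, b]] makes the integrand continuous on the whole line. *)
    set (clamp := fun s => Rmax a (Rmin b s)).
    assert (clamp_in : forall s, (a <= clamp s <= b)%R).
    { intros s. unfold clamp. split; [apply Rmax_l|].
      apply Rmax_lub; [lra | apply Rmin_l]. }
    assert (clamp_id : forall s, (a <= s <= b)%R -> clamp s = s).
    { intros s Hs. unfold clamp. now rewrite Rmin_right, Rmax_right by lra. }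
    assert (Cclamp : forall s, continuous clamp s).
    { intros s. apply continuity_pt_filterlim.
      apply (continuity_pt_ext (fun s => (a + (b + s - Rabs (b - s)) / 2
         + Rabs (a - (b + s - Rabs (b - s)) / 2)) / 2)%R).
      { intros r. unfold clamp, Rmin, Rmax, Rabs.
        repeat destruct Rle_dec; repeat destruct Rcase_abs; lra. }
      reg. }
    assert (X0 : forall s, x (clamp s) - al <> 0).
    { intros s H0. apply (Hal (clamp s) (clamp_in s)). rewrite E by apply clamp_in; simpl.
      replace (x (clamp s)) with (x (clamp s) - al + al) by ring. rewrite H0. ring. }
    set (phi := fun s => / (x (clamp s) - al) * dx (clamp s)).
    assert (Cphi : forall s, continuous phi s).
    { intros s. unfold phi. apply continuous_Cmult; [apply continuous_Cinv|]; trivial.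
      - apply continuous_Cminus; [|apply continuous_const].
        apply (continuous_comp clamp x); [apply Cclamp|].
        exact (is_derive_C_continuous _ _ _ (Hx _)).
      - apply (continuous_comp clamp dx); [apply Cclamp | apply Cx]. }
    set (L := fun s => RInt_C phi a s).
    assert (HL : forall s, is_derive_C L s (phi s)).
    { intros s. apply (is_derive_RInt (V := C_R_NormedModule)) with a.
      - apply filter_forall. intros r. apply is_RInt_C_continuous. intros; apply Cphi.
      - apply Cphi. }
    assert (HLb : L b = I).
    { apply is_RInt_C_unique. apply (is_RInt_ext (V := C_R_NormedModule)) with (2 := HI).
      rewrite Rmin_left, Rmax_right by lra. intros t Ht.
      rewrite (pullback_C1 _ g a b x y dx dy (conj Hx Cx) Hy E t Ht).
      unfold phi, eval_form; simpl. rewrite clamp_id by lra. ring. }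
    assert (HLa : L a = 0).
    { apply (RInt_point (V := C_R_CompleteNormedModule)). }
    assert (Ec : Cexp (- L a) * (x a - al) = Cexp (- L b) * (x b - al)).
    { apply (eq_is_derive (V := C_R_NormedModule) (fun s => Cexp (- L s) * (x s - al))); trivial.
      intros t Ht. evar_last.
      - apply is_derive_C_mult.
        + apply is_derive_C_exp. apply (is_derive_opp (V := C_R_NormedModule)), HL.
        + apply is_derive_C_minus; [apply Hx | apply is_derive_C_const].
      - pose proof (X0 t) as X0t. unfold phi. rewrite clamp_id in X0t |- * by lra.
        change (Cexp (- L t) * - (/ (x t - al) * dx t) * (x t - al)
           + Cexp (- L t) * (dx t - 0) = 0).
        field. trivial. }
    rewrite HLa, HLb in Ec. replace (- RtoC 0) with (RtoC 0) in Ec by ring.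
    rewrite Cexp_0, Cmult_1_l in Ec. rewrite Ec, Cmult_assoc, <- Cexp_plus.
    replace (I + - I) with (RtoC 0) by ring. rewrite Cexp_0. ring.
  - pose proof (piecewise_C1_lt _ _ _ H1). pose proof (piecewise_C1_lt _ _ _ H2).
    destruct (is_line_integral_split (du_form (fun u => / (u - al))) g a b c I) as (I1 & I2 & J1 & J2 & ->);
      [lra | exact HI |].
    rewrite <- (IH2 I2), <- (IH1 I1); trivial.
    + rewrite Cplus_comm, Cexp_plus. ring.
    + intros t Ht; apply Hal; lra.
    + intros t Ht; apply Hal; lra.
Qed.

Lemma C1_holomorphic_dlog (al : C) : C1_holomorphic (fun u => u <> al) (fun u => / (u - al)).
Proof.
  apply C1_holomorphic_inv.
  - apply C1_holomorphic_plus; [apply C1_holomorphic_id | apply C1_holomorphic_const].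
  - intros z Hz H. apply Hz. replace z with (z - al + al) by ring. rewrite H. ring.
Qed.

(** On a closed curve the previous identity says that [exp I = 1]. *)
Lemma winding_number (al : C) (g : R -> C * C) (a b : R) (I : C) :
  piecewise_C1 g a b -> fst (g a) = fst (g b) ->
  (forall t, (a <= t <= b)%R -> fst (g t) <> al) ->
  is_line_integral (du_form (fun u => / (u - al))) g a b I ->
  exists k : Z, I = RtoC (IZR k) * (RtoC 2 * RtoC PI * Ci).
Proof.
  intros Hg Hc Hal HI. apply Cexp_eq_1.
  pose proof (exp_integral_dlog al g a b I Hg Hal HI) as H. rewrite Hc in H.
  pose proof (piecewise_C1_lt _ _ _ Hg).
  assert (N : fst (g b) - al <> 0).
  { intros N. apply (Hal b); [lra|]. replace (fst (g b)) with (fst (g b) - al + al) by ring.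
    rewrite N. ring. }
  replace (Cexp I) with (Cexp I * (fst (g b) - al) / (fst (g b) - al)) by (field; trivial).
  rewrite H. field. trivial.
Qed.

(** * The residue at a single pole *)

Lemma continuous_C1_holomorphic {U : UniformSpace} (D : C -> Prop) (k : C -> C) (f : U -> C) (x : U) :
  C1_holomorphic D k -> D (f x) -> continuous f x -> continuous (fun y => k (f y)) x.
Proof.
  intros [dk Hk] Hx Hf. destruct (Hk _ Hx) as (_ & Ck & _).
  exact (continuous_comp f k x Hf Ck).
Qed.

(** The primitive is the integral, over [s] from [eta] to 1, of
    [k (al + s (u - al)) (u - al)]: differentiating the integrand in [u] gives the same
    result as differentiating [s k (al + s (u - al))] in [s].  The parameter stays away
    from [s = 0] because [k] may have a pole at [al]. *)
Lemma dilation_potential (D : C -> Prop) (al : C) (eta : R) (k : C -> C) :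
  open D -> (forall u s, D u -> (0 < s <= 1)%R -> D (al + RtoC s * (u - al))) ->
  C1_holomorphic D k -> (0 < eta <= 1)%R ->
  potential (fun p => D (fst p))
    (du_form (fun u => k u - RtoC eta * k (al + RtoC eta * (u - al))))
    (fun p => RInt_C (fun s => k (al + RtoC s * (fst p - al)) * (fst p - al)) eta 1).
Proof.
  intros HD Hstar [dk Hk] Heta x y dx dy [Hx Cx] _ t Ht; simpl in *.
  assert (Cxx : forall r, continuous x r) by (intros r; exact (is_derive_C_continuous _ _ _ (Hx r))).
  set (z := fun p : R * R => al + RtoC (snd p) * (x (fst p) - al)).
  assert (Cfst : forall p : R * R, continuous (fun p : R * R => x (fst p) - al) p).
  { intros p. apply continuous_Cminus; [|apply continuous_const].
    apply (continuous_comp (fun p : R * R => fst p) x); [apply continuous_fst | apply Cxx]. }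
  assert (Csnd : forall p : R * R, continuous (fun p : R * R => RtoC (snd p)) p).
  { intros p. apply continuous_RtoC, continuous_snd. }
  assert (Cdx : forall p : R * R, continuous (fun p : R * R => dx (fst p)) p).
  { intros p. apply (continuous_comp (fun p : R * R => fst p) dx); [apply continuous_fst | apply Cx]. }
  assert (Cz : forall p : R * R, continuous z p).
  { intros p. apply continuous_Cplus; [apply continuous_const|]. now apply continuous_Cmult. }
  set (U := fun p : R * R => D (z p)).
  set (f := fun r s : R => k (z (r, s)) * (x r - al)).
  set (df := fun r s : R => dk (z (r, s)) * (RtoC s * dx r) * (x r - al) + k (z (r, s)) * dx r).
  assert (Hmin : Rmin eta 1 = eta) by (apply Rmin_left; lra).
  assert (Hmax : Rmax eta 1 = 1%R) by (apply Rmax_right; lra).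
  assert (HU : forall s, (eta <= s <= 1)%R -> U (t, s)).
  { intros s Hs. apply (Hstar (x t) s); [exact Ht | lra]. }
  replace (eval_form _ _ _) with (RInt_C (df t) eta 1).
  - apply (is_derive_C_RInt_param f df eta 1 t U).
    + intros [r s] Hp; simpl. unfold f, df.
      destruct (Hk _ Hp) as (K1 & K2 & K3).
      apply (is_derive_C_mult (fun r => k (z (r, s))) (fun r => x r - al)).
      * apply (K1 (fun r => z (r, s))); [reflexivity|].
        replace (RtoC s * dx r) with (0 + (0 * (x r - al) + RtoC s * (dx r - 0))) by ring.
        apply (is_derive_C_plus (fun _ => al) (fun r => RtoC s * (x r - al)));
          [apply is_derive_C_const|].
        apply (is_derive_C_mult (fun _ => RtoC s) (fun r => x r - al)); [apply is_derive_C_const|].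
        apply is_derive_C_minus; [apply Hx | apply is_derive_C_const].
      * replace (dx r) with (dx r - 0) by ring.
        apply is_derive_C_minus; [apply Hx | apply is_derive_C_const].
    + intros p Hp. destruct (Hk _ Hp) as (K1 & K2 & K3).
      apply (continuous_ext (fun q => k (z q) * (x (fst q) - al))); [now intros []|].
      apply continuous_Cmult; [|apply Cfst]. now apply (continuous_comp z k).
    + intros p Hp. destruct (Hk _ Hp) as (K1 & K2 & K3).
      apply (continuous_ext (fun q => dk (z q) * (RtoC (snd q) * dx (fst q)) * (x (fst q) - al)
         + k (z q) * dx (fst q))); [now intros []|].
      pose proof (continuous_comp z k p (Cz p) K2) as Ck.
      pose proof (continuous_comp z dk p (Cz p) K3) as Cdk.
      pose proof (continuous_Cmult _ _ p Cdk (continuous_Cmult _ _ p (Csnd p) (Cdx p))) as C1.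
      exact (continuous_Cplus _ _ p (continuous_Cmult _ _ p C1 (Cfst p))
               (continuous_Cmult _ _ p Ck (Cdx p))).
    + rewrite Hmin, Hmax. intros s Hs. apply (Cz (t, s)).
      now apply HD, HU.
    + rewrite Hmin, Hmax.
      assert (L : locally t (fun r => D (x r))) by (apply (Cxx t); now apply HD).
      revert L. apply filter_imp. intros r Hr s Hs. apply (Hstar (x r) s); [exact Hr | lra].
  - unfold eval_form; simpl. rewrite Cmult_0_l, Cplus_0_r.
    apply is_RInt_C_unique.
    replace ((k (x t) - RtoC eta * k (al + RtoC eta * (x t - al))) * dx t)
      with (RtoC 1 * k (z (t, 1%R)) * dx t - RtoC eta * k (z (t, eta)) * dx t).
    2: { unfold z; simpl. replace (al + 1 * (x t - al)) with (x t) by ring. ring. }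
    apply (is_RInt_C_derive (fun s => RtoC s * k (z (t, s)) * dx t));
      rewrite Hmin, Hmax; intros s Hs; destruct (Hk _ (HU s Hs)) as (K1 & K2 & K3).
    + unfold df.
      replace (dk (z (t, s)) * (RtoC s * dx t) * (x t - al) + k (z (t, s)) * dx t)
        with ((1 * k (z (t, s)) + RtoC s * (dk (z (t, s)) * (x t - al))) * dx t
              + RtoC s * k (z (t, s)) * 0) by ring.
      apply (is_derive_C_mult (fun s => RtoC s * k (z (t, s))) (fun _ => dx t));
        [|apply is_derive_C_const].
      assert (Id : is_derive_C (fun r => RtoC r) s 1).
      { apply (is_derive_C_RtoC (fun r => r)). exact (is_derive_id (K := R_AbsRing) s). }
      apply (is_derive_C_mult (fun s => RtoC s) (fun s => k (z (t, s)))); trivial.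
      apply (K1 (fun s => z (t, s))); [reflexivity|].
      replace (x t - al) with (0 + (1 * (x t - al) + RtoC s * 0)) by ring.
      apply (is_derive_C_plus (fun _ => al) (fun r => RtoC r * (x t - al)));
        [apply is_derive_C_const|].
      apply (is_derive_C_mult (fun r => RtoC r) (fun _ => x t - al)); trivial.
      apply is_derive_C_const.
    + assert (Cp : continuous (fun r : R => (t, r) : R * R) s).
      { apply (continuous_comp_2 (fun _ : R => t) (fun r : R => r) (fun a b => (a, b)));
          [apply continuous_const | apply continuous_id |].
        apply (continuous_ext (fun p : R * R => p)); [now intros [] | apply continuous_id]. }
      assert (Czs : continuous (fun r => z (t, r)) s).
      { apply (continuous_comp (fun r : R => (t, r) : R * R) z); [exact Cp | apply Cz]. }
      assert (Cid : continuous (fun r : R => RtoC r) s) by apply continuous_RtoC, continuous_id.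
      pose proof (continuous_comp (fun r => z (t, r)) k s Czs K2) as Ck.
      pose proof (continuous_comp (fun r => z (t, r)) dk s Czs K3) as Cdk.
      apply (continuous_Cplus (fun r => dk (z (t, r)) * (RtoC r * dx t) * (x t - al))
               (fun r => k (z (t, r)) * dx t)).
      * apply continuous_Cmult; [|apply continuous_const].
        apply (continuous_Cmult (fun r => dk (z (t, r))) (fun r => RtoC r * dx t)); [exact Cdk|].
        apply continuous_Cmult; [exact Cid | apply continuous_const].
      * apply (continuous_Cmult (fun r => k (z (t, r))) (fun _ => dx t)); [exact Ck | apply continuous_const].
Qed.

Lemma C1_holomorphic_dilation (D : C -> Prop) (al : C) (eta : R) (k : C -> C) :
  (forall u s, D u -> (0 < s <= 1)%R -> D (al + RtoC s * (u - al))) ->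
  C1_holomorphic D k -> (0 < eta <= 1)%R ->
  C1_holomorphic D (fun u => RtoC eta * k (al + RtoC eta * (u - al))).
Proof.
  intros Hstar [dk Hk] He. apply C1_holomorphic_mult; [apply C1_holomorphic_const|].
  exists (fun u => dk (al + RtoC eta * (u - al)) * RtoC eta). intros u Hu.
  destruct (Hk _ (Hstar u eta Hu He)) as (K1 & K2 & K3).
  assert (Cz : continuous (fun u => al + RtoC eta * (u - al)) u).
  { apply continuous_Cplus; [apply continuous_const|].
    apply continuous_Cmult; [apply continuous_const|].
    apply continuous_Cminus; [apply continuous_id | apply continuous_const]. }
  split; [|split].
  - intros w t dw Hw Hd. rewrite <- Cmult_assoc.
    apply (K1 (fun s => al + RtoC eta * (w s - al))); [now rewrite Hw|].
    replace (RtoC eta * dw) with (0 + (0 * (w t - al) + RtoC eta * (dw - 0))) by ring.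
    apply (is_derive_C_plus (fun _ => al) (fun s => RtoC eta * (w s - al)));
      [apply is_derive_C_const|].
    apply (is_derive_C_mult (fun _ => RtoC eta) (fun s => w s - al)); [apply is_derive_C_const|].
    apply is_derive_C_minus; [apply Hd | apply is_derive_C_const].
  - now apply (continuous_comp (fun u => al + RtoC eta * (u - al)) k).
  - apply continuous_Cmult; [|apply continuous_const].
    now apply (continuous_comp (fun u => al + RtoC eta * (u - al)) dk).
Qed.

Lemma dilation_invariance (D : C -> Prop) (al : C) (eta : R) (k : C -> C)
    (g : R -> C * C) (a b : R) (I J : C) :
  open D -> (forall u s, D u -> (0 < s <= 1)%R -> D (al + RtoC s * (u - al))) ->
  C1_holomorphic D k -> (0 < eta <= 1)%R ->
  piecewise_C1 g a b -> fst (g a) = fst (g b) -> (forall t, (a <= t <= b)%R -> D (fst (g t))) ->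
  is_line_integral (du_form k) g a b I ->
  is_line_integral (du_form (fun u => RtoC eta * k (al + RtoC eta * (u - al)))) g a b J ->
  I = J.
Proof.
  intros HD Hstar Hk He Hg Hc HgD HI HJ.
  pose proof (C1_holomorphic_dilation D al eta k Hstar Hk He) as Hk'.
  pose proof (line_integral_potential _ _ _ g a b (dilation_potential D al eta k HD Hstar Hk He)) as P.
  simpl in P. rewrite Hc in P.
  pose proof (du_form_integral_minus _ _ _ _ _ _ _ HI HJ) as M.
  assert (E : I - J = 0).
  { apply (line_integral_unique _ g a b _ _ M).
    evar_last; [apply P; trivial |].
    - intros p Hp. split; [|apply continuous_const].
      apply continuous_Cminus.
      + apply (continuous_C1_holomorphic D k (fun p : C * C => fst p)); trivial. apply continuous_fst.
      + apply (continuous_C1_holomorphic D _ (fun p : C * C => fst p) p Hk'); trivial. apply continuous_fst.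
    - ring. }
  replace I with (I - J + J) by ring. rewrite E. ring.
Qed.

Definition punctured_disc (al : C) (rho : R) (u : C) : Prop := (0 < Cmod (u - al) < rho)%R.

Lemma open_punctured_disc (al : C) (rho : R) : open (punctured_disc al rho).
Proof.
  assert (Cm : forall u, continuous (fun u => Cmod (u - al)) u).
  { intros u. apply continuous_Cmod, continuous_Cminus; [apply continuous_id | apply continuous_const]. }
  apply open_and.
  - apply (open_comp (fun u => Cmod (u - al)) (fun r => 0 < r)%R); [intros u _; apply Cm | apply open_gt].
  - apply (open_comp (fun u => Cmod (u - al)) (fun r => r < rho)%R); [intros u _; apply Cm | apply open_lt].
Qed.

Lemma Cmod_dilation (al u : C) (s : R) : (0 <= s)%R ->
  Cmod (al + RtoC s * (u - al) - al) = (s * Cmod (u - al))%R.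
Proof.
  intros Hs. replace (al + RtoC s * (u - al) - al) with (RtoC s * (u - al)) by ring.
  now rewrite Cmod_mult, Cmod_R, Rabs_pos_eq.
Qed.

Lemma punctured_disc_star (al : C) (rho : R) (u : C) (s : R) :
  punctured_disc al rho u -> (0 < s <= 1)%R -> punctured_disc al rho (al + RtoC s * (u - al)).
Proof.
  unfold punctured_disc. intros Hu Hs. rewrite Cmod_dilation by lra. nra.
Qed.

(** By [dilation_invariance] the curve may be replaced by its dilate of ratio [eta].
    There [k] is close to [r / (u - al)], uniformly as [eta] tends to 0. *)
Lemma residue_single_pole (al r : C) (rho : R) (k : C -> C) (g : R -> C * C) (a b : R) (I J : C) :
  C1_holomorphic (punctured_disc al rho) k ->
  (forall e, (0 < e)%R -> exists d, (0 < d)%R /\ forall u, punctured_disc al rho u ->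
     (Cmod (u - al) < d)%R -> (Cmod ((u - al) * k u - r) <= e)%R) ->
  piecewise_C1 g a b -> fst (g a) = fst (g b) ->
  (forall t, (a <= t <= b)%R -> punctured_disc al rho (fst (g t))) ->
  is_line_integral (du_form k) g a b I ->
  is_line_integral (du_form (fun u => / (u - al))) g a b J ->
  I = r * J.
Proof.
  intros Hk Hr Hg Hc HgD HI HJ.
  pose proof (piecewise_C1_lt _ _ _ Hg) as Hab.
  assert (N : forall t, (a <= t <= b)%R -> fst (g t) - al <> 0).
  { intros t Ht. apply Cmod_gt_0, (HgD t Ht). }
  destruct (piecewise_C1_bounded (fun p => Cmod (/ (fst p - al))) g a b Hg) as [B HB].
  { intros t Ht. apply continuous_Cmod, continuous_Cinv; [|now apply N].
    apply continuous_Cminus; [apply continuous_fst | apply continuous_const]. }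
  destruct (piecewise_C1_length g a b Hg) as (L & HL0 & HL).
  assert (B0 : (0 <= B)%R).
  { apply Rle_trans with (1 := Cmod_ge_0 (/ (fst (g a) - al))). apply HB. lra. }
  assert (rho0 : (0 < rho)%R).
  { assert (Ha : (a <= a <= b)%R) by lra. destruct (HgD a Ha). lra. }
  assert (S : forall e, (0 < e)%R -> (Cmod (I - r * J) <= e * B * L)%R).
  { intros e He. destruct (Hr e He) as (d & Hd & Hde).
    set (eta := Rmin 1 (d / rho)).
    assert (dr : (0 < d / rho)%R) by now apply Rdiv_lt_0_compat.
    assert (Heta : (0 < eta <= 1)%R).
    { split; [now apply Rmin_glb_lt; [lra|] | apply Rmin_l]. }
    assert (Hed : (eta * rho <= d)%R).
    { apply Rle_trans with (d / rho * rho)%R; [|right; field; lra].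
      apply Rmult_le_compat_r; [lra | apply Rmin_r]. }
    destruct (du_form_integral_exists _ _ g a b
      (C1_holomorphic_dilation _ al eta k (punctured_disc_star al rho) Hk Heta) Hg HgD) as [I' HI'].
    rewrite (dilation_invariance _ al eta k g a b I I' (open_punctured_disc al rho)
      (punctured_disc_star al rho) Hk Heta Hg Hc HgD HI HI').
    pose proof (du_form_integral_minus _ _ _ _ _ _ _ HI' (du_form_integral_scal r _ _ _ _ _ HJ)) as M.
    apply (HL _ (e * B)%R _) with (3 := M); [nra|].
    intros t Ht; simpl.
    set (u := fst (g t)) in *. pose proof (N t Ht) as Nt. fold u in Nt.
    pose proof (HgD t Ht) as Dt. fold u in Dt.
    set (v := al + RtoC eta * (u - al)).
    replace (RtoC eta * k v - r * / (u - al)) with (((v - al) * k v - r) * / (u - al)).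
    2: { unfold v at 1. field. trivial. }
    rewrite Cmod_mult. apply Rmult_le_compat; try apply Cmod_ge_0.
    - apply Hde; [now apply punctured_disc_star|]. unfold v. rewrite Cmod_dilation by lra.
      destruct Dt. nra.
    - now apply HB. }
  assert (Z : Cmod (I - r * J) = 0%R).
  { apply Rle_antisym; [|apply Cmod_ge_0]. apply le_epsilon. intros e He.
    assert (BL : (0 <= B * L)%R) by now apply Rmult_le_pos.
    apply Rle_trans with (e / (B * L + 1) * B * L)%R.
    - apply S. apply Rdiv_lt_0_compat; lra.
    - rewrite Rplus_0_l. replace (e / (B * L + 1) * B * L)%R with (e * (B * L / (B * L + 1)))%R by (field; lra).
      rewrite <- (Rmult_1_r e) at 2. apply Rmult_le_compat_l; [lra|].
      apply Rmult_le_reg_r with (B * L + 1)%R; [lra|]. field_simplify; lra. }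
  apply Cmod_eq_0 in Z. replace I with (I - r * J + r * J) by ring. rewrite Z. ring.
Qed.

(** * The residues of the logarithmic derivative of exp - 1 *)

Lemma continuous_C_epsilon (f : C -> C) (z : C) : continuous f z ->
  forall e, (0 < e)%R -> exists d, (0 < d)%R /\
    forall u, (Cmod (u - z) < d)%R -> (Cmod (f u - f z) < e)%R.
Proof.
  intros Hf e He.
  assert (Hc : continuous (fun u => Cmod (f u - f z)) z).
  { apply continuous_Cmod, continuous_Cminus; [exact Hf | apply continuous_const]. }
  assert (L : locally (T := C_UniformSpace) z (fun u => (Cmod (f u - f z) < e)%R)).
  { apply (Hc (fun r => (r < e)%R)). apply (open_lt e).
    replace (f z - f z) with (RtoC 0) by ring. now rewrite Cmod_0. }
  destruct L as [d Hd]. exists d. split; [apply cond_pos|].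
  intros u Hu. apply Hd.
  pose proof (Rmax_Cmod (u - z)) as M.
  split.
  - apply Rle_lt_trans with (2 := Hu). apply Rle_trans with (2 := M). apply Rmax_l.
  - apply Rle_lt_trans with (2 := Hu). apply Rle_trans with (2 := M). apply Rmax_r.
Qed.

(** [Cexp z - 1 - z] is the integral of [(Cexp (s z) - 1) z] over [s] in [[0, 1]]. *)
Lemma Cexp_first_order (e : R) : (0 < e)%R -> exists d, (0 < d)%R /\
  forall z, (Cmod z < d)%R -> (Cmod (Cexp z - 1) <= e)%R /\ (Cmod (Cexp z - 1 - z) <= e * Cmod z)%R.
Proof.
  intros He.
  destruct (continuous_C_epsilon Cexp 0 (continuous_Cexp (fun z => z) _ (continuous_id _)) e He)
    as (d & Hd & H).
  assert (H1 : forall z, (Cmod z < d)%R -> (Cmod (Cexp z - 1) <= e)%R).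
  { intros z Hz. left. rewrite <- Cexp_0. apply H. now replace (z - 0) with z by ring. }
  exists d. split; [trivial|]. intros z Hz. split; [now apply H1|].
  assert (HI : is_RInt_C (fun s => (Cexp (RtoC s * z) - 1) * z) 0 1
    ((Cexp (RtoC 1 * z) - RtoC 1 * z) - (Cexp (RtoC 0 * z) - RtoC 0 * z))).
  { assert (Id : forall s : R, is_derive_C (fun r => RtoC r * z) s z).
    { intros s. evar_last.
      - apply (is_derive_C_mult (fun r => RtoC r) (fun _ => z)); [|apply is_derive_C_const].
        apply (is_derive_C_RtoC (fun r => r)). exact (is_derive_id (K := R_AbsRing) s).
      - change (RtoC 1 * z + RtoC s * 0 = z). ring. }
    apply (is_RInt_C_derive (fun s => Cexp (RtoC s * z) - RtoC s * z)); intros s _.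
    - replace ((Cexp (RtoC s * z) - 1) * z) with (Cexp (RtoC s * z) * z - z) by ring.
      apply (is_derive_C_minus (fun s => Cexp (RtoC s * z)) (fun s => RtoC s * z)); [|apply Id].
      apply (is_derive_C_exp (fun s => RtoC s * z)), Id.
    - apply continuous_Cmult; [|apply continuous_const].
      apply continuous_Cminus; [|apply continuous_const].
      apply (continuous_Cexp (fun s => RtoC s * z)).
      exact (is_derive_C_continuous _ _ _ (Id s)). }
  replace (Cexp z - 1 - z) with
    ((Cexp (RtoC 1 * z) - RtoC 1 * z) - (Cexp (RtoC 0 * z) - RtoC 0 * z)).
  2: { rewrite Cmult_1_l, Cmult_0_l, Cexp_0. ring. }
  rewrite <- norm_C_R.
  apply (norm_RInt_le (V := C_R_NormedModule) (fun s => (Cexp (RtoC s * z) - 1) * z)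
    (fun _ => (e * Cmod z)%R) 0 1); [lra | | exact HI |].
  - intros s Hs. rewrite norm_C_R, Cmod_mult.
    apply Rmult_le_compat_r; [apply Cmod_ge_0|]. apply H1.
    rewrite Cmod_mult, Cmod_R, Rabs_pos_eq by lra.
    pose proof (Cmod_ge_0 z). nra.
  - evar_last; [apply is_RInt_const|]. unfold scal; simpl; unfold mult; simpl. ring.
Qed.

(** The logarithmic derivative of [Cexp z - 1]. *)
Definition dlog_expm1 (z : C) : C := Cexp z / (Cexp z - 1).

Lemma Cminus_neq_0 (z w : C) : z <> w -> z - w <> 0.
Proof. intros H E. apply H. replace z with (z - w + w) by ring. rewrite E. ring. Qed.

(** From the identity [z q - 1 = (z (e^z - 1) - (e^z - 1 - z)) / (e^z - 1)], in which
    the numerator is [o(z)] and the denominator is equivalent to [z]. *)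
Lemma dlog_expm1_residue (e : R) : (0 < e)%R -> exists d, (0 < d)%R /\
  forall z, (Cmod z < d)%R -> Cexp z <> 1 -> (Cmod (z * dlog_expm1 z - 1) <= e)%R.
Proof.
  intros He. set (e' := Rmin (1 / 2) (e / 4)).
  assert (e1 : (e' <= 1 / 2)%R) by apply Rmin_l.
  assert (e2 : (e' <= e / 4)%R) by apply Rmin_r.
  assert (e0 : (0 < e')%R) by (apply Rmin_glb_lt; lra).
  destruct (Cexp_first_order e' e0) as (d & Hd & H). exists d. split; [trivial|].
  intros z Hz Hz1. destruct (H z Hz) as [Ha Hb].
  pose proof (Cminus_neq_0 _ _ Hz1) as N.
  replace (z * dlog_expm1 z - 1) with ((z * (Cexp z - 1) - (Cexp z - 1 - z)) / (Cexp z - 1))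
    by (unfold dlog_expm1; field; trivial).
  rewrite Cmod_div by trivial.
  pose proof (proj1 (Cmod_gt_0 _) N) as Np. apply Rle_div_l; [exact Np|].
  pose proof (Cmod_triangle (z * (Cexp z - 1)) (- (Cexp z - 1 - z))) as T1.
  rewrite Cmod_opp, Cmod_mult in T1.
  pose proof (Cmod_triangle (Cexp z - 1) (- (Cexp z - 1 - z))) as T2.
  rewrite Cmod_opp in T2.
  replace (Cexp z - 1 + - (Cexp z - 1 - z)) with z in T2 by ring.
  pose proof (Cmod_ge_0 z).
  change (z * (Cexp z - 1) - (Cexp z - 1 - z)) with (z * (Cexp z - 1) + - (Cexp z - 1 - z)).
  apply Rle_trans with (1 := T1).
  assert (Cmod z * Cmod (Cexp z - 1) <= Cmod z * e')%R by (apply Rmult_le_compat_l; trivial).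
  assert (Cmod z <= 2 * Cmod (Cexp z - 1))%R by nra.
  nra.
Qed.

(** The logarithmic derivative of [y^2 - 1 = (y - 1) (y + 1)] with [y = Cexp (z / 2)];
    the factor [y + 1] is, up to sign, the value of [y - 1] at a translate of [z] by an
    odd multiple of [2 pi i]. *)
Lemma dlog_expm1_duplication (z w : C) : Cexp z <> 1 -> Cexp w = - RtoC 1 ->
  dlog_expm1 z = / RtoC 2 * (dlog_expm1 (z / RtoC 2) + dlog_expm1 (z / RtoC 2 + w)).
Proof.
  intros Hz Hw. unfold dlog_expm1.
  assert (E : Cexp z = Cexp (z / RtoC 2) * Cexp (z / RtoC 2)).
  { rewrite <- Cexp_plus. f_equal. field. }
  rewrite Cexp_plus, Hw, E in *. set (y := Cexp (z / RtoC 2)) in *.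
  assert (N1 : y - 1 <> 0) by (apply Cminus_neq_0; intros ->; apply Hz; ring).
  assert (N2 : y + 1 <> 0).
  { intros N. apply Hz. replace y with (y + 1 - 1) by ring. rewrite N. ring. }
  assert (N3 : y * y - 1 <> 0).
  { replace (y * y - 1) with ((y - 1) * (y + 1)) by ring. now apply Cmult_neq_0. }
  assert (N4 : y * RtoC (-1) - 1 <> 0).
  { intros N. apply N2. replace (y + 1) with (- (y * RtoC (-1) - 1)) by ring. rewrite N. ring. }
  field. repeat split; trivial.
Qed.

Definition ipi (b : Z) : C := RtoC (IZR b) * (RtoC PI * Ci).

Lemma Cexp_ipi_odd (b : Z) : Z.Odd b -> Cexp (ipi b) = - RtoC 1.
Proof.
  intros [h ->].
  replace (ipi (2 * h + 1)) with (RtoC (IZR h) * (RtoC 2 * RtoC PI * Ci) + RtoC PI * Ci).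
  2: { unfold ipi. rewrite plus_IZR, mult_IZR, RtoC_plus, RtoC_mult. ring. }
  rewrite Cexp_plus. replace (Cexp (RtoC (IZR h) * (RtoC 2 * RtoC PI * Ci))) with (RtoC 1).
  2: { symmetry. apply Cexp_eq_1. now exists h. }
  replace (RtoC PI * Ci) with ((0, PI)%R : C) by (apply injective_projections; simpl; ring).
  unfold Cexp; simpl. rewrite exp_0, cos_PI, sin_PI. apply injective_projections; simpl; ring.
Qed.

Lemma Cmod_ipi (b : Z) : Cmod (ipi b) = (IZR (Z.abs b) * PI)%R.
Proof.
  unfold ipi. pose proof PI_RGT_0.
  rewrite !Cmod_mult, !Cmod_R, Cmod_Ci, abs_IZR, (Rabs_pos_eq PI) by lra. ring.
Qed.

(** The logarithmic derivative of [Cexp ((u - i pi a) / M) - 1].  Its poles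
    [i pi (a + 2 M k)] are simple with residue 1, for every [M]. *)
Definition dlog_dilated (M a : Z) (u : C) : C :=
  / RtoC (IZR M) * dlog_expm1 ((u - ipi a) / RtoC (IZR M)).

Lemma RtoC_IZR_neq_0 (M : Z) : (0 < M)%Z -> RtoC (IZR M) <> 0.
Proof. intros H E. apply RtoC_inj in E. apply IZR_lt in H. lra. Qed.

(** Halving the set of poles: the classes of [a] and of [a - 2 M s] modulo [4 M] make up
    the class of [a] modulo [2 M].  The freedom in [s] is used to keep the
    representatives small. *)
Lemma dlog_dilated_duplication (M a s : Z) (u : C) : (0 < M)%Z -> Z.Odd s ->
  Cexp ((u - ipi a) / RtoC (IZR M)) <> 1 ->
  dlog_dilated M a u = dlog_dilated (2 * M) a u + dlog_dilated (2 * M) (a - 2 * M * s) u.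
Proof.
  intros HM Hs Hu. pose proof (RtoC_IZR_neq_0 M HM) as NM.
  unfold dlog_dilated. rewrite (dlog_expm1_duplication _ (ipi s) Hu (Cexp_ipi_odd s Hs)).
  rewrite mult_IZR, RtoC_mult.
  assert (E1 : (u - ipi a) / RtoC (IZR M) / RtoC 2 = (u - ipi a) / (RtoC 2 * RtoC (IZR M)))
    by (field; trivial).
  assert (E2 : (u - ipi a) / RtoC (IZR M) / RtoC 2 + ipi s
               = (u - ipi (a - 2 * M * s)) / (RtoC 2 * RtoC (IZR M))).
  { unfold ipi. rewrite minus_IZR, !mult_IZR, RtoC_minus, !RtoC_mult. field. trivial. }
  rewrite E2, E1. field. trivial.
Qed.

Lemma dlog_dilated_poles (M a c : Z) (u : C) : (0 < M)%Z -> Z.Even (a - c) ->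
  Cexp ((u - ipi a) / RtoC (IZR M)) = 1 -> Cexp (u - ipi c) = 1.
Proof.
  intros HM [h Hh] H. pose proof (RtoC_IZR_neq_0 M HM) as NM.
  apply Cexp_eq_1 in H. destruct H as [k Hk]. apply Cexp_eq_1. exists (h + k * M)%Z.
  replace (u - ipi c) with ((u - ipi a) / RtoC (IZR M) * RtoC (IZR M) + ipi (a - c)).
  2: { unfold ipi. rewrite minus_IZR, RtoC_minus. field. trivial. }
  rewrite Hk, Hh. unfold ipi. rewrite plus_IZR, !mult_IZR, RtoC_plus, !RtoC_mult. ring.
Qed.

Lemma C1_holomorphic_dlog_dilated (D : C -> Prop) (M a : Z) : (0 < M)%Z ->
  (forall u, D u -> Cexp ((u - ipi a) / RtoC (IZR M)) <> 1) ->
  C1_holomorphic D (dlog_dilated M a).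
Proof.
  intros HM HD.
  assert (E : C1_holomorphic D (fun u => Cexp ((u - ipi a) * / RtoC (IZR M)))).
  { apply C1_holomorphic_exp, C1_holomorphic_mult; [|apply C1_holomorphic_const].
    apply C1_holomorphic_plus; [apply C1_holomorphic_id | apply C1_holomorphic_const]. }
  apply C1_holomorphic_mult; [apply C1_holomorphic_const|].
  apply C1_holomorphic_mult; [exact E|].
  apply C1_holomorphic_inv.
  - apply C1_holomorphic_plus; [exact E | apply C1_holomorphic_const].
  - intros u Hu. apply Cminus_neq_0, HD, Hu.
Qed.

Lemma integer_multiple_plus (A z w : C) :
  integer_multiple A z -> integer_multiple A w -> integer_multiple A (z + w).
Proof.
  intros [k ->] [l ->]. exists (k + l)%Z. rewrite plus_IZR, RtoC_plus. ring.
Qed.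

Lemma integer_multiple_scal (A z : C) (k : Z) :
  integer_multiple A z -> integer_multiple A (z * RtoC (IZR k)).
Proof. intros [l ->]. exists (l * k)%Z. rewrite mult_IZR, RtoC_mult. ring. Qed.

(** A curve in the disc of radius [pi M] about 0 is at distance less than [2 pi M] from
    the pole [i pi a], whereas the other poles are not. *)
Lemma dlog_dilated_residue (f : C -> C) (M a : Z) (g : R -> C * C) (x y : R) (A I : C) :
  C1_holomorphic (fun _ => True) f -> (0 < M)%Z -> (Z.abs a <= M)%Z ->
  piecewise_C1 g x y -> fst (g x) = fst (g y) ->
  (forall t, (x <= t <= y)%R -> (Cmod (fst (g t)) < PI * IZR M)%R) ->
  (forall t, (x <= t <= y)%R -> fst (g t) <> ipi a) ->
  integer_multiple A ((RtoC 2 * RtoC PI * Ci) * f (ipi a)) ->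
  is_line_integral (du_form (fun u => f u * dlog_dilated M a u)) g x y I ->
  integer_multiple A I.
Proof.
  intros Hf HM Ha Hg Hc HR Hne HA HI. pose proof PI_RGT_0 as P0.
  pose proof (IZR_lt _ _ HM) as HM'. pose proof (RtoC_IZR_neq_0 M HM) as NM.
  set (D := punctured_disc (ipi a) (2 * PI * IZR M)).
  assert (HgD : forall t, (x <= t <= y)%R -> D (fst (g t))).
  { intros t Ht. split; [apply Cmod_gt_0, Cminus_neq_0, Hne, Ht|].
    apply Rle_lt_trans with (1 := Cmod_triangle _ _). rewrite Cmod_opp, Cmod_ipi.
    apply IZR_le in Ha. specialize (HR t Ht). nra. }
  assert (HD : forall u, D u -> Cexp ((u - ipi a) / RtoC (IZR M)) <> 1).
  { intros u [Hu1 Hu2] H. apply Cexp_eq_1 in H. destruct H as [k Hk].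
    assert (E : u - ipi a = RtoC (IZR k * (2 * PI) * IZR M) * Ci).
    { replace (u - ipi a) with ((u - ipi a) / RtoC (IZR M) * RtoC (IZR M)) by (field; trivial).
      rewrite Hk, !RtoC_mult. ring. }
    rewrite E, Cmod_mult, Cmod_R, Cmod_Ci, Rmult_1_r, !Rabs_mult in Hu1, Hu2.
    rewrite (Rabs_pos_eq (IZR M)), (Rabs_pos_eq 2), (Rabs_pos_eq PI), <- abs_IZR in Hu1, Hu2 by lra.
    assert (k0 : (Z.abs k <= 0)%Z).
    { apply Z.lt_succ_r, lt_IZR. simpl.
      apply Rmult_lt_reg_r with (2 * PI * IZR M)%R; [nra | nra]. }
    apply IZR_le in k0. nra. }
  destruct (du_form_integral_exists (fun u => u <> ipi a) _ g x y (C1_holomorphic_dlog (ipi a)) Hg Hne)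
    as [J HJ].
  destruct (winding_number (ipi a) g x y J Hg Hc Hne HJ) as [k Hk].
  assert (EI : I = f (ipi a) * J).
  { apply (residue_single_pole (ipi a) (f (ipi a)) (2 * PI * IZR M)
      (fun u => f u * dlog_dilated M a u) g x y); trivial.
    - apply C1_holomorphic_mult; [|now apply C1_holomorphic_dlog_dilated].
      now apply C1_holomorphic_sub with (2 := Hf).
    - intros e He.
      destruct Hf as [df Hf]. destruct (Hf (ipi a) Logic.I) as (_ & Cf & _).
      set (B := (Cmod (f (ipi a)) + 1)%R).
      assert (B1 : (1 <= B)%R) by (pose proof (Cmod_ge_0 (f (ipi a))); unfold B; lra).
      set (e1 := Rmin 1 (e / 2)).
      assert (e1p : (0 < e1)%R) by (apply Rmin_glb_lt; lra).
      assert (e1a : (e1 <= 1)%R) by apply Rmin_l.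
      assert (e1b : (e1 <= e / 2)%R) by apply Rmin_r.
      destruct (continuous_C_epsilon f (ipi a) Cf e1 e1p) as (d1 & Hd1 & H1).
      assert (e2p : (0 < e / 2 / B)%R) by (apply Rdiv_lt_0_compat; lra).
      destruct (dlog_expm1_residue _ e2p) as (d2 & Hd2 & H2).
      exists (Rmin d1 (d2 * IZR M)). split; [apply Rmin_glb_lt; nra|].
      intros u Hu Hud.
      assert (Hu1 : (Cmod (u - ipi a) < d1)%R) by (apply Rlt_le_trans with (1 := Hud), Rmin_l).
      assert (Hu2 : (Cmod (u - ipi a) < d2 * IZR M)%R) by (apply Rlt_le_trans with (1 := Hud), Rmin_r).
      specialize (H1 u Hu1).
      set (z := (u - ipi a) / RtoC (IZR M)).
      assert (Hz : (Cmod z < d2)%R).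
      { unfold z. rewrite Cmod_div, Cmod_R, Rabs_pos_eq by (trivial; lra).
        apply Rlt_div_l; lra. }
      specialize (H2 z Hz (HD u Hu)).
      replace ((u - ipi a) * (f u * dlog_dilated M a u) - f (ipi a))
        with (f u * (z * dlog_expm1 z - 1) + (f u - f (ipi a))).
      2: { unfold dlog_dilated. fold z. unfold z at 1. field. trivial. }
      apply Rle_trans with (1 := Cmod_triangle _ _). rewrite Cmod_mult.
      assert (Bu : (Cmod (f u) <= B)%R).
      { replace (f u) with (f (ipi a) + (f u - f (ipi a))) by ring.
        apply Rle_trans with (1 := Cmod_triangle _ _). unfold B. lra. }
      assert (Cmod (f u) * Cmod (z * dlog_expm1 z - 1) <= B * (e / 2 / B))%R
        by (apply Rmult_le_compat; trivial; apply Cmod_ge_0).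
      replace (B * (e / 2 / B))%R with (e / 2)%R in H by (field; lra). lra. }
  rewrite EI, Hk.
  replace (f (ipi a) * (RtoC (IZR k) * (RtoC 2 * RtoC PI * Ci)))
    with ((RtoC 2 * RtoC PI * Ci) * f (ipi a) * RtoC (IZR k)) by ring.
  now apply integer_multiple_scal.
Qed.

(** Induction on the number [N] of duplications that are left to perform before
    [M] is large enough for [dlog_dilated_residue].  The bound on [a] persists: as
    [|a| <= M], one of [a - 2 M] and [a + 2 M] is at most [2 M] in absolute value. *)
Lemma dlog_dilated_residues (f : C -> C) (c : Z) (g : R -> C * C) (x y B : R) (A : C) :
  C1_holomorphic (fun _ => True) f ->
  piecewise_C1 g x y -> fst (g x) = fst (g y) ->
  (forall t, (x <= t <= y)%R -> (Cmod (fst (g t)) <= B)%R) ->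
  (forall t, (x <= t <= y)%R -> Cexp (fst (g t) - ipi c) <> 1) ->
  (forall b : Z, Z.Even (b - c) -> integer_multiple A ((RtoC 2 * RtoC PI * Ci) * f (ipi b))) ->
  forall (N : nat) (M a : Z) (I : C), (0 < M)%Z -> (Z.abs a <= M)%Z -> Z.Even (a - c) ->
  (B < PI * (IZR M * 2 ^ N))%R ->
  is_line_integral (du_form (fun u => f u * dlog_dilated M a u)) g x y I ->
  integer_multiple A I.
Proof.
  intros Hf Hg Hc HB Hne HA N.
  assert (Hne' : forall M a t, (0 < M)%Z -> Z.Even (a - c) -> (x <= t <= y)%R ->
    Cexp ((fst (g t) - ipi a) / RtoC (IZR M)) <> 1).
  { intros M a t HM Ha Ht H. apply (Hne t Ht). now apply dlog_dilated_poles with M a. }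
  induction N as [|N IH]; intros M a I HM Ha Hac HBM HI.
  - apply (dlog_dilated_residue f M a g x y A I); auto.
    + intros t Ht. apply Rle_lt_trans with (1 := HB t Ht). simpl in HBM. lra.
    + intros t Ht E. apply (Hne' M a t HM Hac Ht). rewrite E.
      replace ((ipi a - ipi a) / RtoC (IZR M)) with (RtoC 0) by (field; now apply RtoC_IZR_neq_0).
      apply Cexp_0.
  - assert (Hs : exists s, Z.Odd s /\ (Z.abs (a - 2 * M * s) <= 2 * M)%Z).
    { destruct (Z_le_gt_dec 0 a).
      - exists 1%Z. split; [now exists 0%Z | lia].
      - exists (-1)%Z. split; [now exists (-1)%Z | lia]. }
    destruct Hs as (s & Hs & Has).
    set (a' := (a - 2 * M * s)%Z) in *.
    assert (Hac' : Z.Even (a' - c)).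
    { destruct Hac as [h Hh]. exists (h - M * s)%Z. unfold a'. lia. }
    assert (X : forall b, Z.Even (b - c) -> exists J,
      is_line_integral (du_form (fun u => f u * dlog_dilated (2 * M) b u)) g x y J).
    { intros b Hb.
      apply (du_form_integral_exists (fun u => Cexp ((u - ipi b) / RtoC (IZR (2 * M))) <> 1)); trivial.
      - apply C1_holomorphic_mult; [now apply C1_holomorphic_sub with (2 := Hf)|].
        apply C1_holomorphic_dlog_dilated; [lia | trivial].
      - intros t Ht. apply Hne'; trivial; lia. }
    destruct (X a Hac) as [J1 HJ1], (X a' Hac') as [J2 HJ2].
    assert (HBM' : (B < PI * (IZR (2 * M) * 2 ^ N))%R).
    { rewrite mult_IZR. simpl in HBM. lra. }
    replace I with (J1 + J2).
    + apply integer_multiple_plus; [apply (IH (2 * M)%Z a) | apply (IH (2 * M)%Z a')]; trivial; lia.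
    + apply (line_integral_unique (du_form (fun u => f u * dlog_dilated M a u)) g x y); trivial.
      apply (du_form_integral_ext) with (3 := du_form_integral_plus _ _ _ _ _ _ _ HJ1 HJ2); trivial.
      intros t Ht. unfold a'.
      rewrite (dlog_dilated_duplication M a s _ HM Hs (Hne' M a t HM Hac Ht)). ring.
Qed.

(** * Arithmetic of the residues, and the form dv on the curves *)

(** The exponent of 2 starts at 3, for the product of the two consecutive even numbers
    [b - 1] and [b + 1], and increases with every factor [y + 1], [y] odd. *)
Lemma odd_pow_pow2 (b : Z) (v : nat) : Z.Odd b ->
  (2 ^ Z.of_nat (v + 3) | b ^ (2 ^ Z.of_nat (v + 1)) - 1)%Z.
Proof.
  intros [h ->]. induction v as [|v IH].
  - change (2 ^ Z.of_nat (0 + 3))%Z with 8%Z. change (2 ^ Z.of_nat (0 + 1))%Z with 2%Z.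
    rewrite Z.pow_2_r. destruct (Z.Even_or_Odd h) as [[l ->] | [l ->]].
    + exists (l * (2 * l + 1))%Z. ring.
    + exists ((2 * l + 1) * (l + 1))%Z. ring.
  - destruct IH as [q Hq].
    set (y := ((2 * h + 1) ^ (2 ^ Z.of_nat (v + 1)))%Z) in *.
    replace (Z.of_nat (S v + 3)) with (Z.of_nat (v + 3) + 1)%Z by lia.
    replace (Z.of_nat (S v + 1)) with (Z.of_nat (v + 1) + 1)%Z by lia.
    rewrite !Z.pow_add_r, Z.pow_mul_r by lia. fold y.
    change (2 ^ 1)%Z with 2%Z. rewrite Z.pow_2_r.
    replace (y * y - 1)%Z with ((y - 1) * (y - 1 + 2))%Z by ring. rewrite Hq.
    replace (Z.of_nat (v + 3)) with (Z.of_nat (v + 2) + 1)%Z by lia.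
    rewrite Z.pow_add_r by lia.
    exists (q * (q * 2 ^ Z.of_nat (v + 2) + 1))%Z. ring.
Qed.

Lemma sub_1_divide_pow (b : Z) (s : nat) : (b - 1 | b ^ Z.of_nat s - 1)%Z.
Proof.
  induction s as [|s [q Hq]].
  - exists 0%Z. reflexivity.
  - exists (b * q + 1)%Z. rewrite Nat2Z.inj_succ, Z.pow_succ_r by lia.
    replace (b * b ^ Z.of_nat s - 1)%Z with (b * (b ^ Z.of_nat s - 1) + (b - 1))%Z by ring.
    rewrite Hq. ring.
Qed.

Lemma pow2_logn_divide (m : nat) : exists s, m = (2 ^ prime.logn 2 m * s)%nat.
Proof.
  destruct (ssrbool.elimT div.dvdnP (prime.pfactor_dvdnn 2 m)) as [s Hs]. exists s.
  rewrite Nat.mul_comm. rewrite Hs at 1.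
  assert (E : forall v, ssrnat.expn 2 v = (2 ^ v)%nat).
  { induction v as [|v IH]; [reflexivity|]. rewrite ssrnat.expnS, IH. reflexivity. }
  rewrite E. reflexivity.
Qed.

(** Split [m] into its 2-part and a cofactor.  Valuation 0, which is that of [m = 0] by
    convention, is treated apart, by the divisibility of [b^2 - 1] by 8. *)
Lemma odd_pow_sub_1_divide (b : Z) (m : nat) : Z.Odd b -> Nat.Even m ->
  (2 ^ Z.of_nat (prime.logn 2 m + 2) | b ^ Z.of_nat m - 1)%Z.
Proof.
  intros Hb [h Hm]. destruct (pow2_logn_divide m) as [s Hs].
  destruct (prime.logn 2 m) as [|v].
  - apply Z.divide_trans with (b ^ 2 - 1)%Z.
    + apply Z.divide_trans with (2 ^ Z.of_nat (0 + 3))%Z; [now exists 2%Z | exact (odd_pow_pow2 b 0 Hb)].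
    + rewrite Hm, Nat2Z.inj_mul, Z.pow_mul_r by lia. apply sub_1_divide_pow.
  - apply Z.divide_trans with (b ^ (2 ^ Z.of_nat (v + 1)) - 1)%Z.
    + replace (S v + 2)%nat with (v + 3)%nat by lia. now apply odd_pow_pow2.
    + rewrite Hs at 1. replace (S v) with (v + 1)%nat by lia.
      rewrite Nat2Z.inj_mul, Nat2Z.inj_pow, Z.pow_mul_r by lia. apply sub_1_divide_pow.
Qed.

Lemma kappa_pow2 (m : nat) :
  (kappa (S m) * 2 ^ m)%R = if Nat.even m then (2 ^ (prime.logn 2 m + 2))%R else 2%R.
Proof.
  unfold kappa. rewrite Nat.even_succ, <- Nat.negb_even. replace (S m - 1)%nat with m by lia.
  rewrite !pow_powerRZ. destruct (Nat.even m); simpl negb; cbv iota;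
    rewrite <- powerRZ_add by lra.
  - f_equal. lia.
  - replace (2 - Z.of_nat (S m) + Z.of_nat m)%Z with 1%Z by lia. apply powerRZ_1.
Qed.

(** The class modulo 2 of the integers [b] for which [i pi b] is a pole of [dv]. *)
Definition sign_parity (e : Sign) : Z := match e with Plus => 0 | Minus => 1 end.

(** Periods will be integer multiples of [period_unit n] times this index. *)
Definition period_index (e : Sign) (n : nat) : R := match e with Plus => 1%R | Minus => kappa n end.

Lemma IZR_pow (b : Z) (m : nat) : IZR (b ^ Z.of_nat m) = (IZR b ^ m)%R.
Proof. symmetry. apply pow_IZR. Qed.

(** For [Plus], [b] is even and [2^m] divides [b^m].  For [Minus], [b] is odd; if [m] is
    odd too, [b^m - 1] is divisible by the even number [b - 1], and nothing better holds. *)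
Lemma divide_period_index (e : Sign) (m : nat) (b : Z) : (0 < m)%nat -> Z.Even (b - sign_parity e) ->
  exists k : Z, (IZR b ^ m - IZR (sign_parity e) ^ m = period_index e (S m) * 2 ^ m * IZR k)%R.
Proof.
  intros Hm [h Hb]. destruct e; unfold sign_parity, period_index in *.
  - exists (h ^ Z.of_nat m)%Z. rewrite pow_i by lia.
    replace b with (2 * h)%Z by lia. rewrite mult_IZR, Rpow_mult_distr, IZR_pow. ring.
  - assert (Ob : Z.Odd b) by (exists h; lia).
    rewrite pow1, kappa_pow2, <- IZR_pow, <- minus_IZR.
    destruct (Nat.even m) eqn:Em.
    + apply Nat.even_spec in Em.
      destruct (odd_pow_sub_1_divide b m Ob Em) as [k Hk]. exists k.
      rewrite Hk, mult_IZR, IZR_pow. ring.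
    + destruct (sub_1_divide_pow b m) as [q Hq]. exists (q * h)%Z.
      rewrite Hq, <- mult_IZR. f_equal. lia.
Qed.

Lemma sgn_ipi (e : Sign) : sgn e = Cexp (- ipi (sign_parity e)).
Proof.
  destruct e; simpl.
  - replace (- ipi 0) with (RtoC 0) by (unfold ipi; ring). symmetry. apply Cexp_0.
  - replace (- ipi 1) with (ipi (-1)) by (unfold ipi; ring).
    rewrite Cexp_ipi_odd by now exists (-1)%Z. ring.
Qed.

Lemma Chat_Cexp_neq_1 (e1 e2 : Sign) (p : C * C) :
  Chat e1 e2 p -> Cexp (fst p - ipi (sign_parity e1)) <> 1.
Proof.
  unfold Chat. intros H E. unfold Cminus in E.
  rewrite Cplus_comm, Cexp_plus, <- sgn_ipi in E. rewrite E in H.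
  apply (Cexp_neq_0 (snd p)).
  assert (S2 : sgn e2 * sgn e2 = 1).
  { destruct e2; simpl; ring. }
  replace (Cexp (snd p)) with (sgn e2 * ((1 + sgn e2 * Cexp (snd p)) - 1)).
  - rewrite H. ring.
  - transitivity (sgn e2 * sgn e2 * Cexp (snd p)); [ring | rewrite S2; ring].
Qed.

(** With [E = sgn e1 e^u] and [sgn e2 e^v = 1 - E], a tangent vector satisfies
    [E du + (1 - E) dv = 0]. *)
Lemma tangent_Chat_dv (e1 e2 : Sign) (p X : C * C) :
  Chat e1 e2 p -> tangent_Chat e1 e2 p X ->
  snd X = dlog_dilated 1 (sign_parity e1) (fst p) * fst X.
Proof.
  intros Hp HX. pose proof (Cminus_neq_0 _ _ (Chat_Cexp_neq_1 e1 e2 p Hp)) as N.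
  unfold dlog_dilated, dlog_expm1, Chat, tangent_Chat in *.
  replace ((fst p - ipi (sign_parity e1)) / RtoC 1) with (- ipi (sign_parity e1) + fst p) by (field; apply C1_nz).
  unfold Cminus in N. rewrite Cplus_comm in N at 1.
  rewrite (Cplus_comm (fst p)) in N.
  rewrite Cexp_plus, <- sgn_ipi in *.
  set (E := sgn e1 * Cexp (fst p)) in *.
  replace (sgn e2 * Cexp (snd p)) with (1 - E) in HX by (rewrite <- Hp; ring).
  assert (N' : E - 1 <> 0) by (intros Z; apply N; rewrite <- Z; ring).
  replace (snd X) with ((E * fst X - (E * fst X + (1 - E) * snd X)) / (E - 1)) by (field; trivial).
  rewrite HX. field. trivial.
Qed.

(** * The form omega and its periods *)

Lemma C2_differentiable_const (c : C) (p : C * C) : C2_differentiable (fun _ => c) p.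
Proof. eexists. apply filterdiff_const. Qed.

Lemma C2_differentiable_fst (p : C * C) : C2_differentiable (fun p => fst p) p.
Proof.
  exists (fun p => fst p).
  apply filterdiff_linear, (is_linear_fst (U := C_NormedModule) (V := C_NormedModule)).
Qed.

Lemma C2_differentiable_snd (p : C * C) : C2_differentiable (fun p => snd p) p.
Proof.
  exists (fun p => snd p).
  apply filterdiff_linear, (is_linear_snd (U := C_NormedModule) (V := C_NormedModule)).
Qed.

Lemma C2_differentiable_mult (f h : C * C -> C) (p : C * C) :
  C2_differentiable f p -> C2_differentiable h p -> C2_differentiable (fun p => f p * h p) p.
Proof.
  (* [C_NormedModule] and [AbsRing_NormedModule C_AbsRing] have the same operations and norm,
     but different uniform structures; [filterdiff_mult_fct] is about the latter. *)
  assert (T : forall k l F,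
    filterdiff (K := C_AbsRing) (U := prod_NormedModule C_AbsRing C_NormedModule C_NormedModule)
      (V := C_NormedModule) k F l <->
    filterdiff (K := C_AbsRing) (U := prod_NormedModule C_AbsRing C_NormedModule C_NormedModule)
      (V := AbsRing_NormedModule C_AbsRing) k F l).
  { intros k l F. split; intros [[H1 H2 H3] H4]; (split; [split|]);
      [exact H1 | exact H2 | exact H3 | exact H4 | exact H1 | exact H2 | exact H3 | exact H4]. }
  intros [lf Hf] [lh Hh]. eexists. apply T.
  exact (filterdiff_mult_fct (K := C_AbsRing)
    (U := prod_NormedModule C_AbsRing C_NormedModule C_NormedModule) f h p lf lh Cmult_comm
    (proj1 (T f lf _) Hf) (proj1 (T h lh _) Hh)).
Qed.

Lemma C2_differentiable_opp (f : C * C -> C) (p : C * C) :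
  C2_differentiable f p -> C2_differentiable (fun p => - f p) p.
Proof. intros [lf Hf]. eexists. exact (filterdiff_opp_fct (V := C_NormedModule) f lf Hf). Qed.

Lemma C2_differentiable_pow (f : C * C -> C) (p : C * C) (m : nat) :
  C2_differentiable f p -> C2_differentiable (fun p => f p ^ m) p.
Proof.
  intros Hf. induction m as [|m IH]; simpl.
  - apply C2_differentiable_const.
  - now apply C2_differentiable_mult.
Qed.

Lemma holomorphic_omega (n : nat) : holomorphic_form (omega n).
Proof.
  intros p.
  assert (H : forall c, C2_differentiable (fun p => c * fst p ^ (n - 2)) p).
  { intros c. apply C2_differentiable_mult; [apply C2_differentiable_const|].
    apply (C2_differentiable_pow (fun p => fst p)), C2_differentiable_fst. }
  split; unfold omega; cbn [du_coef dv_coef].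
  - exact (C2_differentiable_mult _ _ p (H _)
             (C2_differentiable_opp _ p (C2_differentiable_snd p))).
  - exact (C2_differentiable_mult _ _ p (H _) (C2_differentiable_fst p)).
Qed.

(** Tangent lines of a curve carry no non-zero 2-forms. *)
Lemma closed_on_Chat (e1 e2 : Sign) (w : one_form) : closed_form_on_Chat e1 e2 w.
Proof.
  intros p X Y _ HX HY. unfold tangent_Chat in *.
  assert (E : sgn e1 * Cexp (fst p) <> 0).
  { apply Cmult_neq_0; [|apply Cexp_neq_0]. rewrite sgn_ipi. apply Cexp_neq_0. }
  set (A := sgn e1 * Cexp (fst p)) in *. set (B := sgn e2 * Cexp (snd p)) in *.
  unfold ext_deriv.
  replace (fst X * snd Y - snd X * fst Y)
    with (((A * fst X + B * snd X) * snd Y - (A * fst Y + B * snd Y) * snd X) / A)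
    by (field; trivial).
  rewrite HX, HY. field. trivial.
Qed.

Lemma Cpow_is_derive (x : R -> C) (t : R) (dx : C) (m : nat) :
  is_derive_C x t dx -> is_derive_C (fun s => x s ^ S m) t (RtoC (INR (S m)) * x t ^ m * dx).
Proof.
  intros Hx. induction m as [|m IH].
  - apply (is_derive_ext (K := R_AbsRing) (V := C_R_NormedModule) x).
    { intros s. symmetry. apply Cpow_1_r. }
    replace (RtoC (INR 1) * x t ^ 0 * dx) with dx by (simpl; ring). exact Hx.
  - apply (is_derive_ext (K := R_AbsRing) (V := C_R_NormedModule) (fun s => x s * x s ^ S m));
      [reflexivity|].
    replace (RtoC (INR (S (S m))) * x t ^ S m * dx)
      with (dx * x t ^ S m + x t * (RtoC (INR (S m)) * x t ^ m * dx)).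
    + now apply (is_derive_C_mult x (fun s => x s ^ S m)).
    + rewrite (S_INR (S m)), RtoC_plus, !Cpow_S. ring.
Qed.

(** With [n = m + 2], the differential of [s A v - s / n u^(n - 1) v]. *)
Definition exact_part (s A : C) (m : nat) : one_form :=
  OneForm (fun p => - (s / RtoC (INR (S (S m))) * (RtoC (INR (S m)) * fst p ^ m * snd p)))
          (fun p => s * A - s / RtoC (INR (S (S m))) * fst p ^ S m).

Lemma exact_part_potential (s A : C) (m : nat) :
  potential (fun _ => True) (exact_part s A m)
    (fun p => s * A * snd p - s / RtoC (INR (S (S m))) * (fst p ^ S m * snd p)).
Proof.
  intros x y dx dy [Hx _] [Hy _] t _. simpl fst; simpl snd.
  set (r := s / RtoC (INR (S (S m)))).
  assert (H : is_derive_C (fun q => s * A * y q - r * (x q ^ S m * y q)) t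
    ((0 * y t + s * A * dy t) - (0 * (x t ^ S m * y t)
      + r * ((RtoC (INR (S m)) * x t ^ m * dx t) * y t + x t ^ S m * dy t)))).
  { apply (is_derive_C_minus (fun q => s * A * y q) (fun q => r * (x q ^ S m * y q))).
    - apply (is_derive_C_mult (fun _ => s * A) y); [apply is_derive_C_const | apply Hy].
    - apply (is_derive_C_mult (fun _ => r) (fun q => x q ^ S m * y q)); [apply is_derive_C_const|].
      apply (is_derive_C_mult (fun q => x q ^ S m) y); [apply Cpow_is_derive, Hx | apply Hy]. }
  evar_last; [exact H|]. unfold eval_form, exact_part; cbn [du_coef dv_coef fst snd]. fold r. ring.
Qed.

Lemma exact_part_continuous (s A : C) (m : nat) (p : C * C) :
  continuous (du_coef (exact_part s A m)) p /\ continuous (dv_coef (exact_part s A m)) p.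
Proof.
  assert (F : forall q : C * C, continuous (fun p : C * C => fst p) q) by (intros q; apply continuous_fst).
  assert (S : forall q : C * C, continuous (fun p : C * C => snd p) q) by (intros q; apply continuous_snd).
  unfold exact_part; cbn [du_coef dv_coef]. split.
  - apply continuous_Copp, continuous_Cmult; [apply continuous_const|].
    apply continuous_Cmult; [|apply S]. apply continuous_Cmult; [apply continuous_const|].
    now apply (continuous_Cpow (fun p : C * C => fst p)).
  - apply continuous_Cminus; [apply continuous_const|].
    apply continuous_Cmult; [apply continuous_const|].
    now apply (continuous_Cpow (fun p : C * C => fst p)).
Qed.

Lemma omega_continuous (n : nat) (p : C * C) :
  continuous (du_coef (omega n)) p /\ continuous (dv_coef (omega n)) p.
Proof.
  assert (F : forall q : C * C, continuous (fun p : C * C => fst p) q) by (intros q; apply continuous_fst).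
  assert (S : forall q : C * C, continuous (fun p : C * C => snd p) q) by (intros q; apply continuous_snd).
  unfold omega; cbn [du_coef dv_coef]. split; apply continuous_Cmult.
  - apply continuous_Cmult; [apply continuous_const|]. now apply (continuous_Cpow (fun p : C * C => fst p)).
  - apply (continuous_Copp (fun p : C * C => snd p)), S.
  - apply continuous_Cmult; [apply continuous_const|]. now apply (continuous_Cpow (fun p : C * C => fst p)).
  - apply F.
Qed.

(** The coefficient of [u^(n - 1) dv] after the integration by parts, for [n = m + 2]. *)
Definition omega_coef (m : nat) : C := RtoC ((-1) ^ S (S m) / INR (fact (S m))).

(** Integration by parts, followed by the substitution of [dv] on the tangent line. *)
Lemma omega_tangent (e1 e2 : Sign) (m : nat) (A : C) (p X : C * C) :
  Chat e1 e2 p -> tangent_Chat e1 e2 p X ->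
  eval_form (omega (S (S m))) p X
  = eval_form (du_form (fun u => omega_coef m * (u ^ S m - A) * dlog_dilated 1 (sign_parity e1) u)) p X
    + eval_form (exact_part (omega_coef m) A m) p X.
Proof.
  intros Hp HX. pose proof (tangent_Chat_dv e1 e2 p X Hp HX) as E.
  unfold eval_form, omega, du_form, exact_part; cbn [du_coef dv_coef].
  replace (S (S m) - 2)%nat with m by lia.
  assert (Nn : RtoC (INR (S (S m))) <> 0).
  { intros Z. apply RtoC_inj in Z. now apply (not_0_INR (S (S m))). }
  replace (RtoC ((-1) ^ S (S m) * (INR (S (S m)) - 1) / INR (fact (S (S m)))))
    with (omega_coef m * (RtoC (INR (S m)) / RtoC (INR (S (S m))))).
  2: { unfold omega_coef. rewrite <- RtoC_div, <- RtoC_mult by now apply not_0_INR.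
       change (fact (S (S m))) with (S (S m) * fact (S m))%nat. rewrite mult_INR.
       f_equal. rewrite (S_INR (S m)). field.
       split; [apply INR_fact_neq_0|]. rewrite <- S_INR. now apply not_0_INR. }
  transitivity (omega_coef m * (fst p ^ S m - A) * snd X
    + ((- (omega_coef m / RtoC (INR (S (S m))) * (RtoC (INR (S m)) * fst p ^ m * snd p))) * fst X
       + (omega_coef m * A - omega_coef m / RtoC (INR (S (S m))) * fst p ^ S m) * snd X)).
  - rewrite Cpow_S. rewrite (S_INR (S m)), RtoC_plus in Nn |- *.
    set (k := RtoC (INR (S m))) in *. set (w := fst p ^ m). field. trivial.
  - rewrite E at 1. ring.
Qed.

(** The factor [(-1)^n] of [omega_coef] is absorbed in the integer. *)
Lemma period_multiple (e : Sign) (m : nat) (b : Z) : Z.Even (b - sign_parity e) ->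
  integer_multiple (RtoC (period_index e (S (S m))) * period_unit (S (S m)))
    ((RtoC 2 * RtoC PI * Ci) * (omega_coef m * (ipi b ^ S m - ipi (sign_parity e) ^ S m))).
Proof.
  intros Hb. destruct (divide_period_index e (S m) b) as [k Hk]; [lia | trivial |].
  exists ((-1) ^ Z.of_nat (S (S m)) * k)%Z.
  assert (Eb : forall b, ipi b ^ S m = RtoC (IZR b ^ S m) * (RtoC PI * Ci) ^ S m).
  { intros b'. unfold ipi. now rewrite Cpow_mult_l, RtoC_pow. }
  rewrite !Eb.
  replace (RtoC (IZR b ^ S m) * (RtoC PI * Ci) ^ S m
           - RtoC (IZR (sign_parity e) ^ S m) * (RtoC PI * Ci) ^ S m)
    with (RtoC (IZR b ^ S m - IZR (sign_parity e) ^ S m) * (RtoC PI * Ci) ^ S m)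
    by (rewrite RtoC_minus; ring).
  rewrite Hk, mult_IZR, IZR_pow, !RtoC_mult.
  unfold omega_coef, period_unit. replace (S (S m) - 1)%nat with (S m) by lia.
  assert (F : RtoC (INR (fact (S m))) <> 0).
  { intros Z. apply RtoC_inj in Z. exact (INR_fact_neq_0 (S m) Z). }
  replace ((RtoC 2 * RtoC PI * Ci) ^ S (S m))
    with (RtoC 2 * RtoC PI * Ci * (RtoC 2 ^ S m * (RtoC PI * Ci) ^ S m)).
  2: { rewrite (Cpow_S _ (S m)), <- Cpow_mult_l. f_equal. f_equal. ring. }
  rewrite RtoC_div, !RtoC_pow by apply INR_fact_neq_0.
  set (x := (RtoC PI * Ci) ^ S m). set (y := RtoC (-1) ^ S (S m)). set (t := RtoC 2 ^ S m).
  field. exact F.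
Qed.

(** The constant [A] is the value of [u^m] at one of the poles, so that the residue at
    [i pi b] is a difference [b^m - c^m].  Subtracting [A] changes the integral by a
    multiple of the integral of [dv], which vanishes on a loop. *)
Lemma periods_omega (e1 e2 : Sign) (n : nat) : (2 <= n)%nat ->
  has_periods_in (Chat e1 e2) (omega n)
    (integer_multiple (RtoC (period_index e1 n) * period_unit n)).
Proof.
  intros Hn. destruct n as [|[|m]]; try lia. clear Hn.
  intros z (g & [Hg Hc HS] & ->).
  pose (c := sign_parity e1). pose (s := omega_coef m). pose (A := ipi c ^ S m).
  pose (f := fun u => s * (u ^ S m - A)).
  assert (Hf : C1_holomorphic (fun _ => True) f).
  { apply C1_holomorphic_mult; [apply C1_holomorphic_const|].
    apply C1_holomorphic_plus; [|apply C1_holomorphic_const].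
    apply C1_holomorphic_pow, C1_holomorphic_id. }
  assert (Hne : forall t, (0 <= t <= 1)%R -> Cexp (fst (g t) - ipi c) <> 1).
  { intros t Ht. apply (Chat_Cexp_neq_1 e1 e2), HS, Ht. }
  assert (Hc1 : fst (g 0%R) = fst (g 1%R)) by now rewrite Hc.
  assert (HI : exists I, is_line_integral (omega (S (S m))) g 0 1 I).
  { apply line_integral_exists; [exact Hg|]. intros t _. apply omega_continuous. }
  destruct HI as [I HI].
  replace (line_integral (omega (S (S m))) g) with I.
  2: { symmetry. exact (is_RInt_C_unique _ _ _ _ HI). }
  assert (HJ : is_line_integral (exact_part s A m) g 0 1 0).
  { evar_last.
    - apply (line_integral_potential _ _ _ g 0 1 (exact_part_potential s A m)); trivial.
      intros p _. apply exact_part_continuous.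
    - rewrite Hc. simpl. ring. }
  assert (HK : is_line_integral (du_form (fun u => f u * dlog_dilated 1 c u)) g 0 1 I).
  { replace I with (I - 0) by ring.
    apply (line_integral_tangent_ext e1 e2
      (one_form_minus (omega (S (S m))) (exact_part s A m))); trivial.
    - intros p X Hp HX. rewrite eval_form_minus, (omega_tangent e1 e2 m A p X Hp HX).
      fold s c. unfold f. ring.
    - now apply line_integral_minus. }
  destruct (piecewise_C1_bounded (fun p => Cmod (fst p)) g 0 1 Hg) as [B HB].
  { intros t _. apply continuous_Cmod, continuous_fst. }
  destruct (Pow_x_infinity 2) with (b := B) as [N HN]; [rewrite Rabs_pos_eq; lra|].
  specialize (HN N (le_n N)).
  apply (dlog_dilated_residues f c g 0 1 B _ Hf Hg Hc1 HB Hne) with (N := N) (M := 1%Z) (a := c);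
    trivial; try lia.
  - intros b Hb. apply period_multiple, Hb.
  - unfold c. destruct e1; simpl; lia.
  - exists 0%Z. lia.
  - pose proof PI_RGT_0. rewrite Rabs_pos_eq in HN by (apply pow_le; lra).
    pose proof PI2_1. assert (0 < 2 ^ N)%R by (apply pow_lt; lra).
    simpl. nra.
Qed.

Theorem theorem2p1 (n : nat) (hn : (2 <= n)%nat) :
  holomorphic_form (omega n) /\
  (forall e1 e2 : Sign, closed_form_on_Chat e1 e2 (omega n)) /\
  has_periods_in (Chat Plus Plus) (omega n)
    (integer_multiple (period_unit n)) /\
  has_periods_in (Chat Plus Minus) (omega n)
    (integer_multiple (period_unit n)) /\
  has_periods_in (Chat Minus Plus) (omega n)
    (integer_multiple (Cmult (RtoC (kappa n)) (period_unit n))) /\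
  has_periods_in (Chat Minus Minus) (omega n)
    (integer_multiple (Cmult (RtoC (kappa n)) (period_unit n))).
Proof.
  pose proof (fun e2 => periods_omega Plus e2 n hn) as HP.
  pose proof (fun e2 => periods_omega Minus e2 n hn) as HM.
  unfold period_index in HP, HM.
  replace (RtoC 1 * period_unit n) with (period_unit n) in HP by ring.
  split; [apply holomorphic_omega|].
  split; [intros e1 e2; apply closed_on_Chat|].
  split; [exact (HP Plus)|]. split; [exact (HP Minus)|].
  split; [exact (HM Plus) | exact (HM Minus)].
Qed.
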